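(* A graph language is star-free if and only if it is definable in separator logic.
   Context: Graphs are finite, undirected and nonempty. A graph with $i$ ports is a graph together with a tuple of $i$ pairwise distinct distinguished vertices (the ports); $i$ is its arity. A graph language is a set of graphs with ports all of the same arity; complement is taken relative to all graphs of that arity. Treewidth operations: (fusion) for each $k\ge 0$, $k$-fusion takes two graphs of arity $k$, forms their disjoint union and identifies, for each $i\le k$, the $i$-th ports of the two graphs (edges are accumulated); (forget) $k$-forget takes a graph of arity $k+1$ and stops distinguishing port $k+1$; (add) $k$-add takes a graph of arity $k$ and adds a fresh isolated vertex which becomes port $k+1$; (permute) for each $k$ and each permutation of $\{1,\dots,k\}$, reorder the ports. Operations are lifted to languages elementwise. The star-free graph languages form the least class of graph languages containing all finite languages and closed under Boolean operations (union, intersection, complement) and the treewidth operations. Separator logic: first-order logic over the structure whose universe is the set of vertices, with the edge relation $E(x,y)$ and, for every $n\ge 0$, a relation $S_n(x,y,z_1,\dots,z_n)$ holding iff every path from $x$ to $y$ uses some vertex from $\{z_1,\dots,z_n\}$ ($S_0(x,y)$ says $x,y$ are in different connected components). A formula $\varphi(x_1,\dots,x_k)$ with free variables among $x_1,\dots,x_k$ defines the language of arity $k$ consisting of those graphs of arity $k$ that satisfy $\varphi$ when $x_i$ is interpreted as the $i$-th port. A graph language is definable in separator logic if it is the language of such a formula. *)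

(* Defs.v *)
From HB Require Import structures.
From mathcomp Require Import all_boot perm.

Set Implicit Arguments.
Unset Strict Implicit.
Unset Printing Implicit Defensive.

Local Open Scope quotient_scope.

Record graph := Graph {
  vertex :> finType;
  edge : rel vertex;
  edge_sym : symmetric edge;
  edge_irr : irreflexive edge;
  graph_nonempty : 0 < #|vertex| }.

(* The port numbered i in 1..k is [port G] at the ordinal i - 1 of 'I_k. *)
Record pgraph (k : nat) := PGraph {
  pgraph_graph :> graph;
  port : 'I_k -> pgraph_graph;
  port_inj : injective port }.

Definition pgraph_iso k (G H : pgraph k) : Prop :=
  exists f : G -> H,
    [/\ bijective f, forall x y, edge (f x) (f y) = edge x y
      & forall i, f (port G i) = port H i].

(* Sets of graphs with k ports. The sets of MathComp-Analysis are not used: they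
   raise a universe inconsistency on types that bundle a finType. *)
Definition language (k : nat) := pgraph k -> Prop.

(* Graphs are taken up to isomorphism, so a graph language of arity k is an
   isomorphism-invariant set of graphs with k ports, and it is finite if it has
   finitely many elements up to isomorphism. *)
Definition graph_language k (L : language k) : Prop :=
  forall G H : pgraph k, pgraph_iso G H -> L G -> L H.

Definition finite_language k (L : language k) : Prop :=
  graph_language L /\
  exists (n : nat) (F : 'I_n -> pgraph k),
    forall G, L G -> exists i, pgraph_iso G (F i).

(* The k-tuple t with a appended at position k (counted from 0). *)
Definition snoc (T : Type) k (t : 'I_k -> T) (a : T) (i : 'I_k.+1) : T :=
  if unlift ord_max i is Some j then t j else a.

Section Fusion.
Variables (k : nat) (G H : pgraph k).

Definition sum_edge : rel (G + H) := fun u v =>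
  match u, v with
  | inl x, inl y => edge x y
  | inr x, inr y => edge x y
  | _, _ => false
  end.

Definition fusion_rel : rel (G + H) := fun u v =>
  match u, v with
  | inl x, inl y => x == y
  | inr x, inr y => x == y
  | inl x, inr y => [exists i, (x == port G i) && (y == port H i)]
  | inr y, inl x => [exists i, (x == port G i) && (y == port H i)]
  end.

Lemma fusion_rel_refl : reflexive fusion_rel.
Proof. by case=> x /=. Qed.

Lemma fusion_rel_sym : symmetric fusion_rel.
Proof. by case=> x [] y //=; rewrite eq_sym. Qed.

Lemma fusion_rel_trans : transitive fusion_rel.
Proof.
case=> y [] x [] z //=; do ?[by move=> /eqP-> | by move=> h /eqP<-].
- move=> /existsP[i /andP[/eqP-> /eqP->]] /existsP[j /andP[/eqP + /eqP->]].
  by move=> /port_inj->.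
- move=> /existsP[i /andP[/eqP-> /eqP->]] /existsP[j /andP[/eqP-> /eqP]].
  by move=> /port_inj->.
Qed.

Canonical fusion_equiv :=
  EquivRel fusion_rel fusion_rel_refl fusion_rel_sym fusion_rel_trans.

Definition fusion_vertex := {eq_quot fusion_rel}.
HB.instance Definition _ := EqQuotient.on fusion_vertex.
HB.instance Definition _ := Countable.on fusion_vertex.
HB.instance Definition _ := isFinite.Build fusion_vertex
  (pcan_enumP (can_pcan (@reprK _ fusion_vertex))).

Definition fusion_edge : rel fusion_vertex := fun x y =>
  [exists u : G + H, exists v : G + H,
    [&& sum_edge u v, \pi_fusion_vertex u == x & \pi_fusion_vertex v == y]].

Lemma fusion_edge_sym : symmetric fusion_edge.
Proof.
have sumC u v : sum_edge u v -> sum_edge v u.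
  by case: u v => x [] y //=; rewrite edge_sym.
have sub x y : fusion_edge x y -> fusion_edge y x.
  move=> /existsP[u /existsP[v /and3P[uv ux vy]]].
  by apply/existsP; exists v; apply/existsP; exists u; rewrite sumC ?ux ?vy.
by move=> x y; apply/idP/idP; apply: sub.
Qed.

Lemma fusion_edge_irr : irreflexive fusion_edge.
Proof.
move=> x; apply/negbTE/negP=> /existsP[u /existsP[v /and3P[uv /eqP<- /eqP]]].
move/eqmodP => /=; case: u v uv => u [] v //= uv /eqP vu;
  by rewrite vu edge_irr in uv.
Qed.

Lemma fusion_nonempty : 0 < #|{: fusion_vertex}|.
Proof.
have /card_gt0P[x _] := graph_nonempty G.
by apply/card_gt0P; exists (\pi_fusion_vertex (inl x)).
Qed.

Definition fusion_graph := Graph fusion_edge_sym fusion_edge_irr fusion_nonempty.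

Definition fusion_port (i : 'I_k) : fusion_graph :=
  \pi_fusion_vertex (inl (port G i)).

Lemma fusion_port_inj : injective fusion_port.
Proof. by move=> i j /eqmodP /= /eqP /port_inj. Qed.

Definition fusion : pgraph k := PGraph fusion_port_inj.

End Fusion.

Section Forget.
Variables (k : nat) (G : pgraph k.+1).

Definition forget_port (i : 'I_k) : G := port G (widen_ord (leqnSn k) i).

Lemma forget_port_inj : injective forget_port.
Proof. by move=> i j /port_inj /(congr1 val) /= /val_inj. Qed.

Definition forget : pgraph k := PGraph forget_port_inj.

End Forget.

Section Add.
Variables (k : nat) (G : pgraph k).

(* The fresh vertex is None. *)
Definition add_edge : rel (option G) := fun u v =>
  if (u, v) is (Some x, Some y) then edge x y else false.

Lemma add_edge_sym : symmetric add_edge.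
Proof. by case=> [x|] [y|] //=; apply: edge_sym. Qed.

Lemma add_edge_irr : irreflexive add_edge.
Proof. by case=> [x|] //=; apply: edge_irr. Qed.

Lemma add_nonempty : 0 < #|{: option G}|.
Proof. by rewrite card_option. Qed.

Definition add_graph := Graph add_edge_sym add_edge_irr add_nonempty.

Definition add_port : 'I_k.+1 -> add_graph :=
  snoc (fun i => Some (port G i)) None.

Lemma add_port_inj : injective add_port.
Proof.
move=> i j; rewrite /add_port /snoc.
case: unliftP => [i' ->|->]; case: unliftP => [j' ->|->] //.
by case=> /port_inj->.
Qed.

Definition add : pgraph k.+1 := PGraph add_port_inj.

End Add.

Section Permute.
Variables (k : nat) (s : 'S_k) (G : pgraph k).

Lemma permute_port_inj : injective (fun i => port G (s i)).
Proof. by move=> i j /port_inj /perm_inj. Qed.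

Definition permute : pgraph k := PGraph permute_port_inj.

End Permute.

Definition lift_op k l (f : pgraph k -> pgraph l) (L : language k) :
    language l :=
  fun G => exists H, L H /\ pgraph_iso G (f H).

Definition lift_op2 k l m (f : pgraph k -> pgraph l -> pgraph m)
    (L : language k) (M : language l) : language m :=
  fun G => exists H K, [/\ L H, M K & pgraph_iso G (f H K)].

(* StarFreeExt makes the class depend only on the elements of a language,
   without assuming extensionality of predicates. *)
Inductive star_free : forall k, language k -> Prop :=
| StarFreeExt k (L M : language k) :
    (forall G, L G <-> M G) -> star_free L -> star_free M
| StarFreeFinite k (L : language k) : finite_language L -> star_free L
| StarFreeUnion k (L M : language k) :
    star_free L -> star_free M -> star_free (fun G => L G \/ M G)
| StarFreeInter k (L M : language k) :
    star_free L -> star_free M -> star_free (fun G => L G /\ M G)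
| StarFreeCompl k (L : language k) :
    star_free L -> star_free (fun G => ~ L G)
| StarFreeFusion k (L M : language k) :
    star_free L -> star_free M -> star_free (lift_op2 (@fusion k) L M)
| StarFreeForget k (L : language k.+1) :
    star_free L -> star_free (lift_op (@forget k) L)
| StarFreeAdd k (L : language k) :
    star_free L -> star_free (lift_op (@add k) L)
| StarFreePermute k (s : 'S_k) (L : language k) :
    star_free L -> star_free (lift_op (permute s) L).

(* A path may have length 0, and its endpoints count as vertices it uses. *)
Definition separates (G : graph) (x y : G) (Z : seq G) : Prop :=
  forall p : seq G, path (@edge G) x p -> last x p = y -> uniq (x :: p) ->
    exists2 z, z \in Z & z \in x :: p.

(* Formulas whose free variables are among x_0, ..., x_{k-1}; a quantifier
   over such formulas binds the last variable x_k of its body. *)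
Inductive formula : nat -> Type :=
| FEq k (x y : 'I_k) : formula k
| FEdge k (x y : 'I_k) : formula k
| FSep k n (x y : 'I_k) (z : n.-tuple 'I_k) : formula k
| FNot k (phi : formula k) : formula k
| FAnd k (phi psi : formula k) : formula k
| FOr k (phi psi : formula k) : formula k
| FEx k (phi : formula k.+1) : formula k
| FAll k (phi : formula k.+1) : formula k.

Fixpoint sat (G : graph) k (phi : formula k) : ('I_k -> G) -> Prop :=
  match phi in formula k return ('I_k -> G) -> Prop with
  | FEq _ x y => fun v => v x = v y
  | FEdge _ x y => fun v => edge (v x) (v y)
  | FSep _ _ x y z => fun v => separates (v x) (v y) (map v z)
  | FNot _ phi => fun v => ~ sat phi v
  | FAnd _ phi psi => fun v => sat phi v /\ sat psi v
  | FOr _ phi psi => fun v => sat phi v \/ sat psi v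
  | FEx _ phi => fun v => exists a, sat phi (snoc v a)
  | FAll _ phi => fun v => forall a, sat phi (snoc v a)
  end.

Definition language_of k (phi : formula k) : language k :=
  fun G => sat phi (port G).

Definition separator_definable k (L : language k) : Prop :=
  exists phi : formula k, forall G, L G <-> language_of phi G.

(* Main.v *)
From Stdlib Require Import FunctionalExtensionality Classical.
From mathcomp Require Import all_boot perm zify.
Require Import Defs.

Set Implicit Arguments.
Unset Strict Implicit.
Unset Printing Implicit Defensive.

Local Open Scope quotient_scope.

(** A formula whose variables are distinct ports becomes star-free by structural
    induction: a quantifier is a forget operation, an edge between two ports is a
    fusion with a one-edge graph, and x, y are separated by Z iff the graph is a
    fusion along its ports of two parts such that x is isolated in one part, y in the
    other, and each other port outside Z in one of them.

    Conversely, the hard case is fusion. The ports cut a graph into the connected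
    components of its other vertices, and a fusion distributes these components
    (and the edges between ports) over its two parts. Up to a given quantifier rank,
    a graph is determined by its edges between ports and by the number, counted up
    to a threshold, of components of each type: this is an Ehrenfeucht-Fraisse
    argument for games whose atomic formulas see connectedness outside the ports
    only, which makes components independent of each other. These numbers are
    definable, and two graphs that agree on them up to twice the threshold admit
    corresponding splittings. *)

(** A fusion asks for a splitting of the vertex set, which is a second-order quantification. No
    formula for it is written: a language is definable as soon as finitely many definable properties
    decide membership, so it is enough to transport a splitting to any other graph with the same
    properties. For this the components must not influence each other. Full separation violates
    that, since a path may leave a component through a port and continue in another one; with all
    ports blocked, each connection lives in one component. Separation is then recovered by following
    a path from port to port, at the price of two more quantifiers. The threshold is doubled because
    each of the two sides needs its counts up to the threshold, and a number that is at least twice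
    the threshold can always be divided so as to serve both. *)

(** * Tuples with one more entry, and valuations *)

Lemma snoc_max T k (t : 'I_k -> T) a : snoc t a ord_max = a.
Proof. by rewrite /snoc unlift_none. Qed.

Lemma snoc_lift T k (t : 'I_k -> T) a i : snoc t a (lift ord_max i) = t i.
Proof. by rewrite /snoc liftK. Qed.

Lemma widen_lift k (i : 'I_k) : widen_ord (leqnSn k) i = lift ord_max i.
Proof. by apply: val_inj; rewrite /= /bump leqNgt ltn_ord. Qed.

Lemma comp_snoc T S (h : T -> S) k (t : 'I_k -> T) a :
  h \o snoc t a = snoc (h \o t) (h a).
Proof.
by apply: functional_extensionality => i; rewrite /= /snoc; case: unlift.
Qed.

Lemma snoc_eta T k (t : 'I_k.+1 -> T) :
  snoc (t \o lift ord_max) (t ord_max) = t.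
Proof.
apply: functional_extensionality => i; rewrite /snoc.
by case: unliftP => [j ->|->].
Qed.

Lemma snoc_comp_lift T k (t : 'I_k -> T) a : snoc t a \o lift ord_max = t.
Proof. by apply: functional_extensionality => i; rewrite /= snoc_lift. Qed.

Definition lift_var l m (r : 'I_l -> 'I_m) : 'I_l.+1 -> 'I_m.+1 :=
  snoc (lift ord_max \o r) ord_max.

Lemma comp_lift_var T l m (r : 'I_l -> 'I_m) (v : 'I_m -> T) a :
  snoc v a \o lift_var r = snoc (v \o r) a.
Proof.
rewrite comp_snoc snoc_max; congr snoc.
by apply: functional_extensionality => i; rewrite /= snoc_lift.
Qed.

Definition no_val T (i : 'I_0) : T := False_rect T (notF (ltn_ord i)).

Lemma val0_eq T (f g : 'I_0 -> T) : f = g.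
Proof. by apply: functional_extensionality; case. Qed.

(** * Separation as reachability *)

Section Avoid.
Variable G : graph.
Implicit Types (x y : G) (B : {set G}).

Definition avoid B : rel G := fun x y => [&& edge x y, x \notin B & y \notin B].

Lemma avoid_sym B : symmetric (avoid B).
Proof. by move=> x y; rewrite /avoid edge_sym; case: (edge _ _) => //=; rewrite andbC. Qed.

Lemma avoid_connect_sym B : connect_sym (avoid B).
Proof. exact: sym_connect_sym (@avoid_sym B). Qed.

Lemma connect_avoid_notin B x y :
  connect (avoid B) x y -> x \notin B -> y \notin B.
Proof.
move=> /connectP[p + ->]; elim: p x => //= z p IH x /andP[/and3P[_ _ zB] pp] _.
exact: IH.
Qed.

(** Reachability is reflexive even at a vertex of Z, whereas a path that starts in Z is already cut;
    hence the conjunct [x \notin Z]. A y in Z needs no such care, as no edge of [avoid] leads to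
    it. *)
Lemma separatesP x y (Z : seq G) :
  separates x y Z <->
  ~~ ((x \notin Z) && connect (avoid [set z in Z]) x y).
Proof.
split.
- move=> sep; apply/negP => /andP[xZ /connectP[p0 pp0 ly]].
  case: (shortenP pp0) ly => p pp up _ ly.
  have pe : path (@edge G) x p by apply: sub_path pp => u v /and3P[].
  have [z zZ] := sep p pe (esym ly) up.
  suff: all [pred u | u \notin Z] (x :: p).
    by move=> /allP h /h /=; rewrite zZ.
  rewrite /= xZ /=; elim: p {up ly pe} x xZ pp {pp0 sep} => //= u p IH x xZ.
  by move=> /andP[/and3P[_ _]]; rewrite inE => uZ pp; rewrite uZ (IH u).
- move=> nc p pp ly _; case: (boolP (has (mem Z) (x :: p))) => [/hasP[z]|].
    by exists z.
  move=> nh; case/negP: nc; move: nh; rewrite /= negb_or => /andP[xZ pZ].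
  rewrite xZ /=; apply/connectP; exists p => //.
  elim: p x xZ pp pZ {ly} => //= u p IH x xZ /andP[xu pp].
  rewrite negb_or => /andP[uZ pZ].
  by rewrite IH // /avoid xu !inE uZ xZ.
Qed.

(** A vertex of B reaches only itself once B is removed, and this is the case that [x = y] adds to
    non-separation. *)
Lemma connect_avoidE B x y :
  connect (avoid B) x y <-> x = y \/ ~ separates x y (enum B).
Proof.
have -> : separates x y (enum B) <-> ~~ ((x \notin B) && connect (avoid B) x y).
  rewrite separatesP mem_enum.
  by have -> : [set z in enum B] = B by apply/setP=> z; rewrite inE mem_enum.
split=> [c|[->|/negP]]; last by rewrite negbK => /andP[].
- case: (boolP (x \in B)) => xB; last by right; rewrite c.
  left; case/connectP: c => [[|z p] //= + _].
  by rewrite /avoid xB andbF.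
- exact: connect0.
Qed.

End Avoid.

Lemma eq_separates (G : graph) (x y : G) (Z Z' : seq G) :
  Z =i Z' -> separates x y Z <-> separates x y Z'.
Proof.
move=> h; rewrite !separatesP h.
by have -> : [set z in Z] = [set z in Z'] by apply/setP => z; rewrite !inE h.
Qed.

(** * Renaming of variables *)

Fixpoint rename l (phi : formula l) : forall m, ('I_l -> 'I_m) -> formula m :=
  match phi in formula l return forall m, ('I_l -> 'I_m) -> formula m with
  | FEq _ x y => fun m r => FEq (r x) (r y)
  | FEdge _ x y => fun m r => FEdge (r x) (r y)
  | FSep _ n x y z => fun m r => FSep (r x) (r y) (map_tuple r z)
  | FNot _ phi => fun m r => FNot (rename phi r)
  | FAnd _ phi psi => fun m r => FAnd (rename phi r) (rename psi r)
  | FOr _ phi psi => fun m r => FOr (rename phi r) (rename psi r)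
  | FEx _ phi => fun m r => FEx (rename phi (lift_var r))
  | FAll _ phi => fun m r => FAll (rename phi (lift_var r))
  end.

Lemma sat_rename l (phi : formula l) (G : graph) m (r : 'I_l -> 'I_m)
    (v : 'I_m -> G) :
  sat (rename phi r) v <-> sat phi (v \o r).
Proof.
elim: phi m r v => //=
  [{}l n x y z|{}l phi IH|{}l phi IH psi IH'|{}l phi IH psi IH'|{}l phi IH|{}l phi IH] m r v.
- by rewrite -map_comp.
- by rewrite IH.
- by rewrite IH IH'.
- by rewrite IH IH'.
- by split=> -[a h]; exists a; move: h; rewrite IH comp_lift_var.
- by split=> h a; move: (h a); rewrite IH comp_lift_var.
Qed.

(** * Definable properties of tuples of vertices *)

Definition property (X : Type) := forall G : graph, (X -> G) -> Prop.

(* The variables are indexed by an arbitrary type, so that substitution of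
   variables needs no renaming of formulas. *)
Definition definable X (P : property X) : Prop :=
  exists l (phi : formula l) (h : 'I_l -> X),
    forall (G : graph) (w : X -> G), P G w <-> sat phi (w \o h).

Lemma definable_ord l (P : property 'I_l) :
  definable P -> exists phi : formula l, forall (G : graph) w, P G w <-> sat phi w.
Proof.
move=> [m [phi [h def]]]; exists (rename phi h) => G w.
by rewrite def sat_rename.
Qed.

Lemma definable_sat l (phi : formula l) : definable (fun G w => sat phi w).
Proof. by exists l, phi, id. Qed.

Section Closure.
Variable X : Type.
Implicit Types P Q : property X.

Lemma eq_definable P Q :
  (forall (G : graph) w, P G w <-> Q G w) -> definable P -> definable Q.
Proof. by move=> PQ [l [phi [h def]]]; exists l, phi, h => G w; rewrite -PQ. Qed.

Lemma definable_subst Y (s : X -> Y) P :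
  definable P -> definable (fun G (w : Y -> G) => P G (w \o s)).
Proof. by move=> [l [phi [h def]]]; exists l, phi, (s \o h) => G w; rewrite def. Qed.

Lemma definable_not P : definable P -> definable (fun G w => ~ P G w).
Proof. by move=> [l [phi [h def]]]; exists l, (FNot phi), h => G w; rewrite def. Qed.

Lemma definable_and P Q :
  definable P -> definable Q -> definable (fun G w => P G w /\ Q G w).
Proof.
move=> [l [phi [h def]]] [m [psi [h' def']]].
exists (l + m), (FAnd (rename phi (@lshift l m)) (rename psi (@rshift l m))).
exists (fun i => match split i with inl a => h a | inr b => h' b end) => G w.
rewrite def def' /= !sat_rename.
have -> : w \o h = (w \o (fun i => match split i with inl a => h a | inr b => h' b end)) \o (@lshift l m).
  by apply: functional_extensionality => i /=; rewrite (unsplitK (inl i)).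
have -> // : w \o h' = (w \o (fun i => match split i with inl a => h a | inr b => h' b end)) \o (@rshift l m).
by apply: functional_extensionality => i /=; rewrite (unsplitK (inr i)).
Qed.

Lemma definable_or P Q :
  definable P -> definable Q -> definable (fun G w => P G w \/ Q G w).
Proof.
move=> dP dQ.
apply: eq_definable (definable_not (definable_and (definable_not dP) (definable_not dQ))).
by move=> G w; case: (classic (P G w)); case: (classic (Q G w)); tauto.
Qed.

Lemma definable_iff P Q :
  definable P -> definable Q -> definable (fun G w => P G w <-> Q G w).
Proof.
move=> dP dQ.
apply: eq_definable (definable_or (definable_and dP dQ)
  (definable_and (definable_not dP) (definable_not dQ))).
by move=> G w; case: (classic (P G w)); case: (classic (Q G w)); tauto.
Qed.

End Closure.

Lemma definable_ex X (P : property (option X)) :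
  definable P -> definable (fun G (w : X -> G) => exists a, P G (oapp w a)).
Proof.
move=> [l [phi [h def]]].
(* The slots of [phi] that stand for [None] are redirected to the bound variable, but they remain in
   the context of the new formula and need some value, [x0]. If X is empty, all slots stand for
   [None] and the context can be empty. *)
have [[x0]|noX] := classic (inhabited X); last first.
  exists 0, (FEx (rename phi (fun _ => ord_max))), (no_val X) => G w /=.
  suff E a : oapp w a \o h = snoc (w \o no_val X) a \o (fun _ => ord_max).
    by split=> -[a Ha]; exists a; move: Ha; rewrite def sat_rename E.
  apply: functional_extensionality => i /=.
  by rewrite snoc_max; case: (h i) => // x; case: noX.
pose r i : 'I_l.+1 := if h i is Some _ then lift ord_max i else ord_max.
exists l, (FEx (rename phi r)), (fun i => odflt x0 (h i)) => G w /=.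
suff E a : oapp w a \o h = snoc (w \o (fun i => odflt x0 (h i))) a \o r.
  by split=> -[a Ha]; exists a; move: Ha; rewrite def sat_rename E.
apply: functional_extensionality => i; rewrite /r /=.
by case hi: (h i) => [x|]; rewrite ?snoc_lift ?snoc_max //= hi.
Qed.

Lemma definable_all X (P : property (option X)) :
  definable P -> definable (fun G (w : X -> G) => forall a, P G (oapp w a)).
Proof.
move=> dP; apply: eq_definable (definable_not (definable_ex (definable_not dP))).
move=> G w; split=> [h a|h [a]]; last by apply; apply: h.
by apply: NNPP => na; apply: h; exists a.
Qed.

(** Over an empty set of variables every formula has a quantifier; the sentence [exists a, a = a] is
    true because graphs are nonempty. *)
Lemma definable_true X : definable (fun G (w : X -> G) => True).
Proof.
have: definable (fun G (w : option X -> G) => w None = w None).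
  by exists 2, (FEq ord0 ord_max), (fun _ => None) => G w /=.
move=> /definable_ex; apply: eq_definable => G w; split=> // _.
by have /card_gt0P[x _] := graph_nonempty G; exists x.
Qed.

Lemma definable_const X (A : Prop) : definable (fun G (w : X -> G) => A).
Proof.
case: (classic A) => hA.
  by apply: eq_definable (definable_true X) => G w; split.
by apply: eq_definable (definable_not (definable_true X)) => G w; split=> // /(_ I).
Qed.

Lemma definable_forall X (I : finType) (P : I -> property X) :
  (forall i, definable (P i)) -> definable (fun G w => forall i, P i G w).
Proof.
move=> dP.
have: definable (fun G w => forall i, i \in enum I -> P i G w).
  elim: (enum I) => [|i s IH].
    by apply: eq_definable (definable_true X) => G w; split.
  apply: eq_definable (definable_and (dP i) IH) => G w.
  split=> [[h1 h2] j|h]; first by rewrite inE => /orP[/eqP->|/h2].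
  by split=> [|j js]; apply: h; rewrite inE ?eqxx // js orbT.
apply: eq_definable => G w; split=> h i; last by move=> _; apply: h.
by apply: h; rewrite mem_enum.
Qed.

Lemma definable_exists X (I : finType) (P : I -> property X) :
  (forall i, definable (P i)) -> definable (fun G w => exists i, P i G w).
Proof.
move=> dP; have := definable_forall (fun i => definable_not (dP i)).
move=> /definable_not; apply: eq_definable => G w.
split=> [h|[i Pi] /(_ i)]; last by [].
by apply: NNPP => n; apply: h => i Pi; apply: n; exists i.
Qed.

Lemma definable_eq X (x y : X) : definable (fun G w => w x = w y).
Proof.
exists 2, (FEq ord0 ord_max), (fun i => if i == ord0 then x else y) => G w.
exact: iff_refl.
Qed.

Lemma definable_edge X (x y : X) : definable (fun G w => edge (w x) (w y)).
Proof.
exists 2, (FEdge ord0 ord_max), (fun i => if i == ord0 then x else y) => G w.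
exact: iff_refl.
Qed.

Lemma definable_separates X (x y : X) n (z : 'I_n -> X) :
  definable (fun G w => separates (w x) (w y) (map (w \o z) (enum 'I_n))).
Proof.
exists n.+2, (@FSep n.+2 n ord_max (lift ord_max ord_max)
  (map_tuple (fun i => lift ord_max (lift ord_max i)) (ord_tuple n))).
exists (snoc (snoc z y) x) => G w /=.
rewrite !snoc_max snoc_lift snoc_max -map_comp.
suff -> : (w \o snoc (snoc z y) x) \o (fun i => lift ord_max (lift ord_max i)) = w \o z.
  exact: iff_refl.
by apply: functional_extensionality => i /=; rewrite !snoc_lift.
Qed.

Lemma definable_ex_ord X m (P : forall G : graph, (X -> G) -> ('I_m -> G) -> Prop) :
  definable (fun (G : graph) (w : X + 'I_m -> G) => P G (w \o inl) (w \o inr)) ->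
  definable (fun G w => exists u, P G w u).
Proof.
elim: m P => [|m IH] P dP.
  have dP' := definable_subst
    (fun s : X + 'I_0 => match s with inl x => x | inr i => no_val X i end) dP.
  apply: eq_definable dP' => G w; split=> [h|[u h]].
    by exists (no_val G); rewrite (val0_eq (no_val G) (w \o no_val X)).
  by move: h; rewrite (val0_eq u (w \o no_val X)).
pose s (z : X + 'I_m.+1) : option (X + 'I_m) := match z with
  | inl x => Some (inl x)
  | inr i => snoc (fun j : 'I_m => Some (inr j)) None i end.
have := definable_ex (definable_subst s dP).
move=> /(eq_definable (Q := fun (G : graph) (w : X + 'I_m -> G) =>
  exists a, P G (w \o inl) (snoc (w \o inr) a))) h.
have {}h : definable (fun (G : graph) (w : X + 'I_m -> G) =>
  exists a, P G (w \o inl) (snoc (w \o inr) a)).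
  apply: h => G w.
  suff E a : (oapp w a \o s) \o inr = snoc (w \o inr) a.
    by split=> -[a Pa]; exists a; move: Pa; rewrite E.
  by apply: functional_extensionality => i /=; rewrite /snoc; case: unlift.
move: h => /(IH (fun G w u => exists a, P G w (snoc u a))).
apply: eq_definable => G w; split=> [[u [a h]]|[u h]].
  by exists (snoc u a).
by exists (u \o lift ord_max), (u ord_max); rewrite snoc_eta.
Qed.

Lemma separator_definableP k (L : language k) :
  (exists2 P : property 'I_k, definable P & forall G, L G <-> P G (port G)) <->
  separator_definable L.
Proof.
split=> [[P /definable_ord[phi def] LP]|[phi def]].
  by exists phi => G; rewrite LP def.
by exists (fun G w => sat phi w) => //; apply: definable_sat.
Qed.

(** The properties divide all graphs into finitely many classes, and by hypothesis L is a union of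
    classes. A formula for L is the disjunction of the descriptions of the classes that L meets. *)
Lemma invariant_definable k (L : language k) (I : finType) (P : I -> property 'I_k) :
  (forall i, definable (P i)) ->
  (forall G H : pgraph k,
     (forall i, P i G (port G) <-> P i H (port H)) -> L G -> L H) ->
  separator_definable L.
Proof.
move=> dP inv; apply/separator_definableP.
pose A (d : {set I}) := exists G, L G /\ forall i, P i G (port G) <-> i \in d.
exists (fun G w => exists d, A d /\ forall i, P i G w <-> i \in d).
  apply: definable_exists => d; apply: definable_and; first exact: definable_const.
  by apply: definable_forall => i; apply: definable_iff => //; apply: definable_const.
move=> G; split=> [LG|[d [[H [LH Hd]] Gd]]].
  suff [d hd] : exists d : {set I}, forall i, P i G (port G) <-> i \in d.
    by exists d; split=> //; exists G.
  have /fin_all_exists[f hf] : forall i, exists b : bool, P i G (port G) <-> b.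
    by move=> i; case: (classic (P i G (port G))) => h; [exists true|exists false].
  by exists [set i | f i] => i; rewrite inE.
by apply: inv LH => i; rewrite Gd.
Qed.

(** * Isomorphisms, fusions without quotients, and subgraphs *)

Lemma pgraph_iso_refl k (G : pgraph k) : pgraph_iso G G.
Proof. by exists id; split=> //; exists id. Qed.

Lemma pgraph_iso_sym k (G H : pgraph k) : pgraph_iso G H -> pgraph_iso H G.
Proof.
move=> [f [[g fK gK] fe fp]]; exists g; split; first by exists f.
  by move=> x y; rewrite -fe !gK.
by move=> i; rewrite -fp fK.
Qed.

Lemma pgraph_iso_trans k (G H K : pgraph k) :
  pgraph_iso G H -> pgraph_iso H K -> pgraph_iso G K.
Proof.
move=> [f [bf fe fp]] [g [bg ge gp]]; exists (g \o f); split.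
- exact: bij_comp.
- by move=> x y /=; rewrite ge fe.
- by move=> i /=; rewrite fp gp.
Qed.

Section FusionEmbeddings.
Variables (k : nat) (G H K : pgraph k).

(** A fusion seen from inside G. The maps preserve edges but need not reflect them: two ports that
    are not adjacent in H may be adjacent in G through K. The third clause names a port of H only;
    injectivity of g gives the same port of K. *)
Definition fusion_embeddings (f : H -> G) (g : K -> G) : Prop :=
  [/\ [/\ injective f, injective g,
          forall i, f (port H i) = port G i & forall i, g (port K i) = port G i],
      forall z, (exists x, z = f x) \/ (exists y, z = g y),
      forall x y, f x = g y -> exists i, x = port H i,
      (forall x y, edge x y -> edge (f x) (f y)) /\
      (forall x y, edge x y -> edge (g x) (g y))
    & forall z z', edge z z' ->
        (exists x y, [/\ z = f x, z' = f y & edge x y]) \/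
        (exists x y, [/\ z = g x, z' = g y & edge x y])].

Lemma fusion_isoP :
  pgraph_iso G (fusion H K) <-> exists f g, fusion_embeddings f g.
Proof.
split.
- move=> /pgraph_iso_sym[h [[h' hK h'K] he hp]].
  exists (fun x => h (\pi_(fusion_vertex H K) (inl x))).
  exists (fun x => h (\pi_(fusion_vertex H K) (inr x))).
  have pE (u v : H + K) : (h (\pi_(fusion_vertex H K) u) = h (\pi_(fusion_vertex H K) v)) -> fusion_rel u v.
    by move/(can_inj hK)/eqmodP.
  split; [split| | |split|].
  + by move=> x y /pE /= /eqP.
  + by move=> x y /pE /= /eqP.
  + by move=> i; rewrite -hp.
  + move=> i; rewrite -hp; congr h; apply/eqmodP => /=.
    by apply/existsP; exists i; rewrite !eqxx.
  + move=> z; rewrite -(h'K z); elim/quotP: (h' z) => -[x|y] _; [left|right].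
      by exists x.
    by exists y.
  + by move=> x y /pE /= /existsP[i /andP[/eqP-> _]]; exists i.
  + move=> x y xy; rewrite he; apply/existsP; exists (inl x); apply/existsP.
    by exists (inl y); rewrite /= xy !eqxx.
  + move=> x y xy; rewrite he; apply/existsP; exists (inr x); apply/existsP.
    by exists (inr y); rewrite /= xy !eqxx.
  + move=> z z'; rewrite -(h'K z) -(h'K z') he.
    move=> /existsP[u /existsP[v /and3P[uv /eqP<- /eqP<-]]].
    case: u v uv => x [] y //= xy; [left|right]; by exists x, y.
- move=> [f [g [[fi gi fp gp] cov meet [ef eg] efg]]].
  apply: pgraph_iso_sym.
  pose h0 (u : H + K) : G := match u with inl x => f x | inr y => g y end.
  (* The fibres of [h0] are the classes of [fusion_rel], so [h0] factors injectively through the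
     quotient. *)
  have h0E u v : fusion_rel u v <-> h0 u = h0 v.
    have dis x y : (exists i, (x == port H i) && (y == port K i)) <-> f x = g y.
      split=> [[i /andP[/eqP-> /eqP->]]|e]; first by rewrite fp gp.
      have [i xi] := meet _ _ e; exists i; rewrite xi eqxx; apply/eqP/gi.
      by rewrite -e xi fp gp.
    case: u v => x [] y /=.
    + by split=> [/eqP->|/fi->].
    + by rewrite -dis; split=> /existsP.
    + by split=> [/existsP/dis|/esym/dis/existsP].
    + by split=> [/eqP->|/gi->].
  pose h (q : fusion H K) : G := h0 (repr (q : fusion_vertex H K)).
  have hpi u : h (\pi_(fusion_vertex H K) u) = h0 u.
    by apply/h0E; apply/eqmodP; rewrite reprK.
  have hinj : injective h.
    move=> p q; elim/quotP: p => u _; elim/quotP: q => v _; rewrite !hpi.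
    by move=> /h0E uv; apply/eqmodP.
  have hsurj z : exists q, h q = z.
    case: (cov z) => -[x ->].
      by exists (\pi_(fusion_vertex H K) (inl x)); rewrite hpi.
    by exists (\pi_(fusion_vertex H K) (inr x)); rewrite hpi.
  exists h; split.
  + have surj' z : exists q, h q == z by have [q <-] := hsurj z; exists q.
    exists (fun z => xchoose (surj' z)) => [q|z]; last by apply/eqP/(xchooseP (surj' z)).
    by apply: hinj; apply/eqP/(xchooseP (surj' (h q))).
  + move=> p q; apply/idP/idP.
      move=> /efg[] [x [y [e1 e2 xy]]]; apply/existsP.
        exists (inl x); apply/existsP; exists (inl y); rewrite /= xy /=.
        by apply/andP; split; apply/eqP/hinj; rewrite hpi.
      exists (inr x); apply/existsP; exists (inr y); rewrite /= xy /=.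
      by apply/andP; split; apply/eqP/hinj; rewrite hpi.
    move=> /existsP[u /existsP[v /and3P[uv /eqP<- /eqP<-]]]; rewrite !hpi.
    by case: u v uv => x [] y //= xy; [apply: ef|apply: eg].
  + by move=> i; rewrite -fp -[f _]/(h0 (inl _)) -hpi.
Qed.

End FusionEmbeddings.

Section Subgraph.
Variables (k : nat) (G : pgraph k) (S : {set G}) (E : rel G).
Hypotheses (E_sym : symmetric E) (port_in : forall i, port G i \in S).
Hypothesis S_nonempty : exists x, x \in S.

(** Besides the restriction to S, the relation E discards edges: two parts of a fusion share all
    ports, but not necessarily the edges between them. *)
Definition sub_edge : rel {x | x \in S} :=
  fun x y => edge (val x) (val y) && E (val x) (val y).

Lemma sub_edge_sym : symmetric sub_edge.
Proof. by move=> x y; rewrite /sub_edge edge_sym E_sym. Qed.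

Lemma sub_edge_irr : irreflexive sub_edge.
Proof. by move=> x; rewrite /sub_edge edge_irr. Qed.

Lemma sub_nonempty : 0 < #|{: {x | x \in S}}|.
Proof. by have [x xS] := S_nonempty; apply/card_gt0P; exists (exist _ x xS). Qed.

Definition sub_graph := Graph sub_edge_sym sub_edge_irr sub_nonempty.

Definition sub_port (i : 'I_k) : sub_graph := exist _ (port G i) (port_in i).

Lemma sub_port_inj : injective sub_port.
Proof. by move=> i j /(congr1 val) /port_inj. Qed.

Definition subgraph : pgraph k := PGraph sub_port_inj.

End Subgraph.

Lemma fusion_subgraphs k (G : pgraph k) (S T : {set G}) (E F : rel G)
    Es Ep En Fs Fp Fn :
  (forall z, (z \in S) || (z \in T)) ->
  (forall z, z \in S -> z \in T -> exists i, z = port G i) ->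
  (forall x y, edge x y -> [&& x \in S, y \in S & E x y] || [&& x \in T, y \in T & F x y]) ->
  pgraph_iso G (fusion (@subgraph k G S E Es Ep En) (@subgraph k G T F Fs Fp Fn)).
Proof.
move=> cov meet eEF; apply/fusion_isoP.
exists val, val; split; [split=> //| | |split|].
- exact: val_inj.
- exact: val_inj.
- move=> z; case/orP: (cov z) => h; [left|right]; by exists (exist _ z h).
- move=> x y e; have [||i xi] := meet (val x); first exact: (valP x).
    by rewrite [val x]e; exact: (valP y).
  by exists i; apply: val_inj.
- by move=> x y /andP[].
- by move=> x y /andP[].
- move=> z z' zz'; case/orP: (eEF _ _ zz') => /and3P[zS z'S EF]; [left|right].
    by exists (exist _ z zS), (exist _ z' z'S); rewrite /sub_edge /= /sub_edge zz' EF.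
  by exists (exist _ z zS), (exist _ z' z'S); rewrite /= /sub_edge zz' EF.
Qed.

(** * Relativisation and invariance under embeddings *)

(** Only the quantifiers are relativised; separation still refers to the paths of the whole graph.
    This agrees with satisfaction in the subgraph on U when no edge leaves U. *)
Fixpoint sat_on (G : graph) (U : pred G) k (phi : formula k) : ('I_k -> G) -> Prop :=
  match phi in formula k return ('I_k -> G) -> Prop with
  | FEq _ x y => fun v => v x = v y
  | FEdge _ x y => fun v => edge (v x) (v y)
  | FSep _ _ x y z => fun v => separates (v x) (v y) (map v z)
  | FNot _ phi => fun v => ~ sat_on U phi v
  | FAnd _ phi psi => fun v => sat_on U phi v /\ sat_on U psi v
  | FOr _ phi psi => fun v => sat_on U phi v \/ sat_on U psi v
  | FEx _ phi => fun v => exists2 a, U a & sat_on U phi (snoc v a)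
  | FAll _ phi => fun v => forall a, U a -> sat_on U phi (snoc v a)
  end.

Section Embedding.
Variables (H G : graph) (f : H -> G).
Hypotheses (f_inj : injective f) (f_edge : forall x y, edge (f x) (f y) = edge x y).
Hypothesis f_closed : forall x z, edge (f x) z -> exists y, z = f y.

(** By [f_closed] a path that starts in the image of f stays in it, so the paths from [f x] are the
    images of the paths from x. *)
Lemma separates_embed x y Z : separates x y Z <-> separates (f x) (f y) (map f Z).
Proof.
split=> sep p pp lp up; last first.
  have [|||z] := sep (map f p).
  - by rewrite (map_path (e' := @edge H) (b := pred0)) //; apply/hasP => -[].
  - by rewrite last_map lp.
  - by rewrite -map_cons map_inj_uniq.
  move=> /mapP[u uZ ->]; rewrite -map_cons mem_map // => up'.
  by exists u.
have [q eq_p] : exists q, p = map f q.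
  elim: p x pp {sep lp up} => [|z p IH] x /=; first by exists [::].
  case/andP=> /f_closed[u ->] /IH[q ->]; by exists (u :: q).
subst p; have [|||u uZ uq] := sep q.
- by move: pp; rewrite (map_path (e' := @edge H) (b := pred0)) //; apply/hasP => -[].
- by apply: f_inj; rewrite -lp last_map.
- by move: up; rewrite -map_cons map_inj_uniq.
- by exists (f u); rewrite -?map_cons mem_map.
Qed.

Lemma sat_embed k (phi : formula k) v :
  sat phi v <-> sat_on (fun a => a \in codom f) phi (f \o v).
Proof.
have codomP (P : G -> Prop) : (exists2 a, a \in codom f & P a) <-> exists a, P (f a).
  split=> [[a /codomP[b ->]]|[a Pa]]; first by exists b.
  by exists (f a) => //; apply: codom_f.
elim: phi v => //= {k}
  [k x y|k x y|k n x y z|k phi IH|k phi IH psi IH'|k phi IH psi IH'|k phi IH|k phi IH] v.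
- by split=> [->|/f_inj].
- by rewrite f_edge.
- by rewrite (map_comp f v) -separates_embed.
- by rewrite IH.
- by rewrite IH IH'.
- by rewrite IH IH'.
- rewrite codomP; split=> -[a h]; exists a; move: h; by rewrite IH comp_snoc.
- split=> h a; last by rewrite IH comp_snoc; apply: h; apply: codom_f.
  by move=> /mapP[b _ ->]; have := h b; rewrite IH comp_snoc.
Qed.

End Embedding.

Lemma sat_on_predT (G : graph) (U : pred G) k (phi : formula k) v :
  (forall x, U x) -> sat_on U phi v <-> sat phi v.
Proof.
move=> UT; elim: phi v => //= {k}
  [k phi IH|k phi IH psi IH'|k phi IH psi IH'|k phi IH|k phi IH] v.
- by rewrite IH.
- by rewrite IH IH'.
- by rewrite IH IH'.
- by split=> [[a _ h]|[a h]]; exists a => //; move: h; rewrite IH.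
- by split=> h a => [|_]; have := h a; rewrite IH; [apply|].
Qed.

Lemma sat_iso (H G : graph) (f : H -> G) k (phi : formula k) v :
  bijective f -> (forall x y, edge (f x) (f y) = edge x y) ->
  sat phi v <-> sat phi (f \o v).
Proof.
move=> [g fK gK] fe; rewrite (sat_embed (can_inj fK) fe).
  apply: sat_on_predT => x /=; rewrite -(gK x); exact: codom_f.
by move=> x z _; exists (g z).
Qed.

(** * Definable languages are star-free *)

Lemma star_free_const k (A : Prop) : star_free (fun _ : pgraph k => A).
Proof.
have sf0 : @star_free k (fun=> False).
  apply: StarFreeFinite; split=> //; exists 0.
  by exists (no_val _).
case: (classic A) => hA; last by apply: StarFreeExt sf0 => G; tauto.
by apply: StarFreeExt (StarFreeCompl sf0) => G; tauto.
Qed.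

Lemma star_free_exists k (I : finType) (L : I -> language k) :
  (forall i, star_free (L i)) -> star_free (fun G => exists i, L i G).
Proof.
move=> sfL; suff: star_free (fun G => exists2 i, i \in enum I & L i G).
  apply: StarFreeExt => G; split=> [[i _ h]|[i h]]; exists i => //.
  by rewrite mem_enum.
elim: (enum I) => [|i s IH].
  by apply: StarFreeExt (star_free_const k False) => G; split=> // -[].
apply: StarFreeExt (StarFreeUnion (sfL i) IH) => G; split.
  by case=> [h|[j js h]]; [exists i|exists j]; rewrite ?inE ?eqxx ?js ?orbT.
by case=> j; rewrite inE => /orP[/eqP->|js] h; [left|right; exists j].
Qed.

Lemma star_free_forall k (I : finType) (L : I -> language k) :
  (forall i, star_free (L i)) -> star_free (fun G => forall i, L i G).
Proof.
move=> sfL.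
apply: StarFreeExt (StarFreeCompl (star_free_exists (fun i => StarFreeCompl (sfL i)))).
move=> G; split=> [h i|h [i]]; last by apply.
by apply: NNPP => nL; apply: h; exists i.
Qed.

Lemma star_free_impl k (A : Prop) (L : language k) :
  star_free L -> star_free (fun G => A -> L G).
Proof.
move=> sfL; apply: StarFreeExt (StarFreeUnion (star_free_const k (~ A)) sfL) => G.
by case: (classic A); tauto.
Qed.

Section OneEdge.
Variables (m : nat) (i j : 'I_m).
Hypothesis neq_ij : i != j.

Definition one_edge : rel 'I_m :=
  fun x y => (x == i) && (y == j) || (x == j) && (y == i).

Lemma one_edge_sym : symmetric one_edge.
Proof. by move=> x y; rewrite /one_edge orbC andbC [in X in _ || X]andbC. Qed.

Lemma one_edge_irr : irreflexive one_edge.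
Proof.
move=> x; rewrite /one_edge; apply/negP => /orP[]/andP[/eqP-> /eqP ij];
by have := neq_ij; rewrite ij eqxx.
Qed.

Lemma one_edge_nonempty : 0 < #|{: 'I_m}|.
Proof. by apply/card_gt0P; exists i. Qed.

Definition one_edge_graph : pgraph m :=
  @PGraph m (Graph one_edge_sym one_edge_irr one_edge_nonempty) id (fun _ _ => id).

End OneEdge.

Lemma star_free_edge m (i j : 'I_m) :
  star_free (fun G : pgraph m => edge (port G i) (port G j)).
Proof.
case: (altP (i =P j)) => [<-|ij].
  by apply: StarFreeExt (star_free_const m False) => G; rewrite edge_irr.
have sf1 : star_free (fun G => pgraph_iso G (one_edge_graph ij)).
  apply: StarFreeFinite; split.
    by move=> G H /pgraph_iso_sym; apply: pgraph_iso_trans.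
  by exists 1, (fun _ => one_edge_graph ij) => G h; exists ord0.
apply: StarFreeExt (StarFreeFusion sf1 (star_free_const m True)) => G; split.
  move=> [H [K [[h [_ he hp]] _ /fusion_isoP[f [g [[_ _ fp _] _ _ [ef _] _]]]]]].
  by rewrite -!fp; apply: ef; rewrite -he !hp /= /one_edge !eqxx.
(* Fusion accumulates edges, so fusing G with an edge that it already has gives G back. *)
move=> e; exists (one_edge_graph ij), G; split=> //; first exact: pgraph_iso_refl.
apply/fusion_isoP; exists (port G : one_edge_graph ij -> G), id; split; [ | | |split|].
- by split=> //; apply: port_inj.
- by move=> z; right; exists z.
- by move=> x y _; exists x.
- move=> x y /= /orP[]/andP[/eqP-> /eqP->] //; by rewrite edge_sym.
- by [].
- by move=> z z' zz'; right; exists z, z'.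
Qed.

(** Ports are pairwise distinct, but variables may take equal values; r records which variables
    share a port. Letting m and r vary carries the induction through the quantifiers. *)
Definition star_free_formula l (phi : formula l) : Prop :=
  forall m (r : 'I_l -> 'I_m), star_free (fun G : pgraph m => sat phi (port G \o r)).

Lemma star_free_FEdge k (i j : 'I_k) : star_free_formula (FEdge i j).
Proof. by move=> m r; apply: star_free_edge. Qed.

Lemma star_free_FNot k (phi : formula k) :
  star_free_formula phi -> star_free_formula (FNot phi).
Proof. by move=> h m r; apply: StarFreeCompl. Qed.

(* The ports of a graph are distinct, hence a quantified vertex is either one of
   the ports or becomes an additional port. *)
Lemma star_free_FEx k (phi : formula k.+1) :
  star_free_formula phi -> star_free_formula (FEx phi).
Proof.
move=> h m r.
have sf1 := star_free_exists (fun i : 'I_m => h m (snoc r i)).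
have sf2 := StarFreeForget (h m.+1 (lift_var r)).
apply: StarFreeExt (StarFreeUnion sf1 sf2) => G; split.
  case=> [[i]|[H [Hphi [f [bf fe fp]]]]].
    by rewrite comp_snoc => Gi; exists (port G i).
  have [g fK gK] := bf; exists (g (port H ord_max)).
  rewrite (sat_iso _ _ bf fe) comp_snoc gK; move: Hphi.
  rewrite -[in sat _ _](snoc_eta (port H)) comp_lift_var.
  suff -> : (port H \o lift ord_max) \o r = f \o (port G \o r) by [].
  by apply: functional_extensionality => i /=; rewrite fp /= /forget_port widen_lift.
move=> [a Ga]; case: (boolP [exists i, port G i == a]) => [/existsP[i /eqP ai]|na].
  by left; exists i; rewrite comp_snoc ai.
right; have inj : injective (snoc (port G) a).
  move=> x y; rewrite /snoc; case: unliftP => [x' ->|->]; case: unliftP => [y' ->|->] //.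
  - by move=> /port_inj->.
  - by move=> e; case/existsP: na; exists x'; rewrite e.
  - by move=> e; case/existsP: na; exists y'; rewrite e.
exists (PGraph inj); split; first by rewrite /= comp_lift_var.
exists id; split=> //; first by exists id.
by move=> i /=; rewrite /forget_port /= widen_lift snoc_lift.
Qed.

Lemma star_free_isolated m (i : 'I_m) :
  star_free (fun G : pgraph m => forall a, ~ edge (port G i) a).
Proof.
have := star_free_FNot (star_free_FEx (star_free_FEdge (lift ord_max i) ord_max)).
move=> /(_ m id); apply: StarFreeExt => G /=.
split=> [h a e|h [a]]; last by rewrite snoc_max snoc_lift => /h.
by apply: h; exists a; rewrite snoc_max snoc_lift.
Qed.

(** W is the set of ports on the side of x. In the first part the ports outside W and z are
    isolated, in the second those in W, so a path from x can change parts only at a port in z. *)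
Lemma separates_fusion m (G : pgraph m) (x y : 'I_m) (z : seq 'I_m) :
  separates (port G x) (port G y) (map (port G) z) <->
  x \in z \/
  exists W : {set 'I_m}, ([&& x \in W, y \notin W & [forall i in W, i \notin z]]) /\
    lift_op2 (@fusion m)
      (fun H => forall i, i \notin z /\ i \notin W -> forall a, ~ edge (port H i) a)
      (fun H => forall i, i \in W -> forall a, ~ edge (port H i) a) G.
Proof.
have memz i : (port G i \in [seq port G i | i <- z]) = (i \in z).
  by rewrite mem_map //; apply: port_inj.
split.
- move=> sep; case: (boolP (x \in z)) => xz; [by left|right].
  pose B : {set G} := [set u in map (port G) z].
  have BP i : (port G i \in B) = (i \in z) by rewrite inE memz.
  (* The first part will take the edges that meet C, the second part all others; both contain all
     ports. *)
  pose C : {set G} := [set u | connect (avoid B) (port G x) u].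
  have xB : port G x \notin B by rewrite BP.
  have CB u : u \in C -> u \notin B.
    by rewrite inE => /connect_avoid_notin; apply.
  have Cstep u v : u \in C -> edge u v -> v \notin B -> v \in C.
    move=> uC uv vB; have := uC; rewrite !inE => /connect_trans; apply.
    by apply: connect1; rewrite /avoid uv vB CB.
  exists [set i | port G i \in C]; split.
    apply/and3P; split; first by rewrite !inE connect0.
      move/separatesP: sep; rewrite memz xz /= => nc.
      by rewrite !inE.
    by apply/forall_inP => i; rewrite inE => /CB; rewrite BP.
  pose P : {set G} := port G @: setT.
  have PP i : port G i \in P by apply: imset_f.
  have inP u : u \in P -> exists i, u = port G i by case/imsetP=> i _ ->; exists i.
  pose E : rel G := fun u v => (u \in C) || (v \in C).
  have Es : symmetric E by move=> u v; rewrite /E orbC.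
  pose F : rel G := fun u v => (u \notin C) && (v \notin C).
  have Fs : symmetric F by move=> u v; rewrite /F andbC.
  have Ep i : port G i \in C :|: P by rewrite inE PP orbT.
  have Fp i : port G i \in ~: C :|: P by rewrite inE PP orbT.
  have En : exists u, u \in C :|: P by exists (port G x).
  have Fn : exists u, u \in ~: C :|: P by exists (port G x).
  exists (subgraph Es Ep En), (subgraph Fs Fp Fn); split.
  + move=> i [iz]; rewrite inE => iC [a aS] /andP[/= ia].
    rewrite /E (negbTE iC) /= => aC.
    have iC' : port G i \in C by apply: Cstep aC _ _; rewrite ?BP // edge_sym.
    by rewrite iC' in iC.
  + by move=> i; rewrite inE => iC [a aS] /andP[_ /=]; rewrite /F iC.
  + apply: fusion_subgraphs.
    * by move=> u; rewrite in_setU in_setU in_setC; case: (u \in C); rewrite ?orbT.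
    * move=> u; rewrite !in_setU in_setC => /orP[->|/inP//] /=.
      by move/inP.
    * move=> u v uv; rewrite !in_setU !in_setC /E /F.
      case: (boolP (u \in C)) => uC; case: (boolP (v \in C)) => vC;
        rewrite ?(negbTE uC) ?(negbTE vC) /= ?andbF ?orbF ?andbT ?orbT //.
        apply: contraR vC => vP.
        apply: (Cstep _ _ uC uv); apply: contra vP; rewrite inE => /mapP[i _ ->].
        exact: PP.
      apply: contraR uC => uP; rewrite edge_sym in uv.
      apply: (Cstep _ _ vC uv); apply: contra uP; rewrite inE => /mapP[i _ ->].
      exact: PP.
- case=> [xz p pp lp up|[W [/and3P[xW yW /forall_inP Wz]]]].
    by exists (port G x); rewrite ?memz ?mem_head.
  move=> [H [K [Hiso Kiso /fusion_isoP[f [g]]]]].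
  move=> [[fi gi fp gp] cov meet [ef eg] efg] p pp lp _.
  (* The first part without its ports outside W: an invariant of the paths that avoid z. *)
  pose C u := exists2 a, u = f a & forall i, a = port H i -> i \in W.
  have Cx : C (port G x).
    by exists (port H x); rewrite ?fp // => i /port_inj <-.
  have nCy : ~ C (port G y).
    move=> [a]; rewrite -fp => /fi <- /(_ y erefl) yW'.
    by rewrite yW' in yW.
  have Cstep u v : C u -> edge u v -> v \notin map (port G) z -> C v.
    move=> [a ua aW] /efg[] [b [c [ub vc bc]]] vz.
      exists c => // i ci; case: (boolP (i \in W)) => // iW.
      case: (Hiso i _ b); last by rewrite edge_sym -ci.
      by split=> //; rewrite -memz -fp -ci -vc.
    have [i ai] := meet a b (etrans (esym ua) ub).
    have bi : b = port K i by apply: gi; rewrite gp -ub ua ai fp.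
    by case: (Kiso i (aW i ai) c); rewrite -bi.
  case: (boolP (has (mem (map (port G) z)) (port G x :: p))) => [/hasP[u]|].
    by exists u.
  rewrite -all_predC => /andP[_ pz]; case: nCy; rewrite -lp.
  elim: p (port G x) Cx pp pz {lp} => //= v p IH u Cu /andP[uv pp] /andP[vz pz].
  by apply: IH => //; apply: Cstep Cu uv vz.
Qed.

Lemma star_free_sat k (phi : formula k) : star_free_formula phi.
Proof.
elim: phi => {k}
  [k x y|k x y|k n x y z|k phi IH|k phi IH psi IH'|k phi IH psi IH'|k phi IH|k phi IH].
- move=> m r; apply: StarFreeExt (star_free_const m (r x = r y)) => G /=.
  by split=> [->|/port_inj].
- exact: star_free_FEdge.
- move=> m r /=.
  apply: StarFreeExt (StarFreeUnion (star_free_const m (r x \in map r z)) _).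
    move=> G; rewrite map_comp; apply: iff_sym; exact: separates_fusion.
  apply: star_free_exists => W; apply: StarFreeInter; first exact: star_free_const.
  apply: StarFreeFusion; apply: star_free_forall => i; apply: star_free_impl;
  exact: star_free_isolated.
- exact: star_free_FNot.
- by move=> m r; apply: StarFreeInter.
- by move=> m r; apply: StarFreeUnion.
- exact: star_free_FEx.
- move=> m r; have := star_free_FNot (star_free_FEx (star_free_FNot IH)).
  move=> /(_ m r); apply: StarFreeExt => G /=.
  split=> [h a|h [a]]; last by apply.
  by apply: NNPP => nh; apply: h; exists a.
Qed.

Lemma definable_star_free k (L : language k) :
  separator_definable L -> star_free L.
Proof.
move=> [phi def]; apply: StarFreeExt (star_free_sat phi id) => G.
by rewrite def.
Qed.

(** * Types of vertices outside the ports *)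

Lemma connect_ind (T : finType) (e : rel T) (x : T) (P : T -> Prop) :
  P x -> (forall y z, connect e x y -> P y -> e y z -> P z) ->
  forall y, connect e x y -> P y.
Proof.
move=> Px step y /connectP[p + ->].
elim/last_ind: p => //= p z IH; rewrite rcons_path last_rcons => /andP[pp ez].
by apply: step ez; [apply/connectP; exists p|apply: IH].
Qed.

Section Types.
Variable k : nat.

Section Atoms.
Variables (G : graph) (p : 'I_k -> G).

Definition port_set : {set G} := [set p i | i : 'I_k].

Lemma mem_port_set i : p i \in port_set.
Proof. exact: imset_f. Qed.

Lemma port_setP x : reflect (exists i, x = p i) (x \in port_set).
Proof.
by apply: (iffP imsetP) => [[i _ ->]|[i ->]]; exists i.
Qed.

Definition blocked j (v : 'I_j -> G) (Z : {set 'I_j}) : {set G} :=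
  port_set :|: [set v i | i in Z].

Lemma blocked0 j (v : 'I_j -> G) : blocked v set0 = port_set.
Proof. by rewrite /blocked imset0 setU0. Qed.

(* The last summand is connectedness outside the ports and the vertices in Z.
   Since paths may not go through ports, the atomic facts about two different
   components of the graph without its ports are independent of each other. *)
Definition atom j : finType :=
  ('I_j * 'I_j + 'I_j * 'I_j + 'I_j * 'I_k + 'I_j * 'I_j * {set 'I_j})%type.

Definition holds j (v : 'I_j -> G) (a : atom j) : bool :=
  match a with
  | inl (inl (inl (a, b))) => v a == v b
  | inl (inl (inr (a, b))) => edge (v a) (v b)
  | inl (inr (a, i)) => edge (v a) (p i)
  | inr (a, b, Z) => connect (avoid (blocked v Z)) (v a) (v b)
  end.

Definition atomic_type j (v : 'I_j -> G) : {set atom j} := [set a | holds v a].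

End Atoms.

(** Hintikka types: equality of two values of [type] means that the duplicator wins the game of n
    rounds. There are finitely many, so finitely many conditions can describe and count them. *)
Fixpoint ty n j : finType :=
  match n with
  | 0 => {set atom j}
  | n'.+1 => ({set atom j} * {set ty n' j.+1})%type
  end.

(** Moves are confined to U, while atoms are evaluated in the whole graph. One notion thus serves
    for a single component and for all vertices off the ports. *)
Fixpoint type (G : graph) (p : 'I_k -> G) (U : {set G}) n :
    forall j, ('I_j -> G) -> ty n j :=
  match n with
  | 0 => fun j v => atomic_type p v
  | n'.+1 => fun j v =>
      (atomic_type p v, [set type p U n' (snoc v a) | a in U])
  end.

Section Pair.
Variables (G H : graph) (p : 'I_k -> G) (q : 'I_k -> H).

Lemma atomic_typeP j (v : 'I_j -> G) (w : 'I_j -> H) :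
  atomic_type p v = atomic_type q w <-> forall a, holds p v a = holds q w a.
Proof.
split=> [/setP e a|e]; first by have := e a; rewrite !inE.
by apply/setP => a; rewrite !inE.
Qed.

Variables (U : {set G}) (W : {set H}).

Lemma type_atomic n j (v : 'I_j -> G) (w : 'I_j -> H) :
  type p U n v = type q W n w -> atomic_type p v = atomic_type q w.
Proof. by case: n => //= n []. Qed.

Lemma type_forth n j (v : 'I_j -> G) (w : 'I_j -> H) a :
  type p U n.+1 v = type q W n.+1 w -> a \in U ->
  exists2 b, b \in W & type p U n (snoc v a) = type q W n (snoc w b).
Proof.
case=> _ e aU.
have : type p U n (snoc v a) \in [set type p U n (snoc v a) | a in U].
  exact: imset_f.
by rewrite e => /imsetP[b bW eb]; exists b.
Qed.

End Pair.

Lemma typeS_intro (G H : graph) (p : 'I_k -> G) (q : 'I_k -> H)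
    (U : {set G}) (W : {set H}) n j
    (v : 'I_j -> G) (w : 'I_j -> H) :
  atomic_type p v = atomic_type q w ->
  (forall a, a \in U -> exists2 b, b \in W & type p U n (snoc v a) = type q W n (snoc w b)) ->
  (forall b, b \in W -> exists2 a, a \in U & type p U n (snoc v a) = type q W n (snoc w b)) ->
  type p U n.+1 v = type q W n.+1 w.
Proof.
move=> at_eq forth back.
suff e : [set type p U n (snoc v a) | a in U] = [set type q W n (snoc w b) | b in W].
  by rewrite /= at_eq; congr pair.
apply/setP => t; apply/imsetP/imsetP => [[a /forth[b bW ->] ->]|[b /back[a aU e] ->]].
  by exists b.
by exists a.
Qed.

Lemma type_back (G H : graph) (p : 'I_k -> G) (q : 'I_k -> H)
    (U : {set G}) (W : {set H}) n j
    (v : 'I_j -> G) (w : 'I_j -> H) b :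
  type p U n.+1 v = type q W n.+1 w -> b \in W ->
  exists2 a, a \in U & type p U n (snoc v a) = type q W n (snoc w b).
Proof. by move=> /esym/type_forth h /h[a aU e]; exists a. Qed.

Lemma type_leq (G H : graph) (p : 'I_k -> G) (q : 'I_k -> H)
    (U : {set G}) (W : {set H}) m n j
    (v : 'I_j -> G) (w : 'I_j -> H) :
  m <= n -> type p U n v = type q W n w -> type p U m v = type q W m w.
Proof.
elim: m n j v w => [|m IH] n j v w mn e; first exact: type_atomic e.
case: n mn e => // n mn e; apply: typeS_intro; first exact: type_atomic e.
  by move=> a /(type_forth e)[b bW eb]; exists b => //; apply: IH eb.
by move=> b /(type_back e)[a aU ea]; exists a => //; apply: IH ea.
Qed.

Lemma blocked_lift (G : graph) (p : 'I_k -> G) j (v : 'I_j -> G) a (Z : {set 'I_j}) :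
  blocked p (snoc v a) (lift ord_max @: Z) = blocked p v Z.
Proof.
rewrite /blocked -imset_comp; congr (_ :|: _); apply: eq_imset => i /=.
by rewrite snoc_lift.
Qed.

(** * The truth of a formula depends only on types *)

Definition port_val (G : graph) (p : 'I_k -> G) j (v : 'I_j -> G) (x : 'I_k + 'I_j) : G :=
  match x with inl i => p i | inr a => v a end.

Definition same_ports (G H : graph) (p : 'I_k -> G) (q : 'I_k -> H) : Prop :=
  forall i l, edge (p i) (p l) = edge (q i) (q l).

Section PortVal.
Variables (G H : graph) (p : 'I_k -> G) (q : 'I_k -> H).
Hypotheses (p_inj : injective p) (q_inj : injective q) (pq : same_ports p q).
Variables (j : nat) (v : 'I_j -> G) (w : 'I_j -> H).
Hypotheses (v_port : forall i, v i \notin port_set p).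
Hypotheses (w_port : forall i, w i \notin port_set q).
Hypothesis at_eq : atomic_type p v = atomic_type q w.

Lemma port_val_eq x y :
  (port_val p v x == port_val p v y) = (port_val q w x == port_val q w y).
Proof.
have nv i l : (p i == v l) = false.
  by apply/eqP => e; have := v_port l; rewrite -e mem_port_set.
have nw i l : (q i == w l) = false.
  by apply/eqP => e; have := w_port l; rewrite -e mem_port_set.
case: x y => x [] y /=.
- by rewrite !inj_eq.
- by rewrite nv nw.
- by rewrite eq_sym nv eq_sym nw.
- by have /atomic_typeP/(_ (inl (inl (inl (x, y))))) := at_eq.
Qed.

Lemma port_val_edge x y :
  edge (port_val p v x) (port_val p v y) = edge (port_val q w x) (port_val q w y).
Proof.
have /atomic_typeP at_eq' := at_eq.
case: x y => x [] y /=.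
- exact: pq.
- by rewrite edge_sym [RHS]edge_sym; apply: (at_eq' (inl (inr (y, x)))).
- exact: (at_eq' (inl (inr (x, y)))).
- exact: (at_eq' (inl (inl (inr (x, y))))).
Qed.

Lemma port_val_mem x Z :
  (port_val p v x \in map (port_val p v) Z) = (port_val q w x \in map (port_val q w) Z).
Proof.
by apply/mapP/mapP => -[y yZ /eqP e]; exists y => //; apply/eqP; move: e;
  rewrite port_val_eq.
Qed.

End PortVal.

(* A path from x to y is cut at the ports on it. The pieces outside the ports are
   described by atomic facts about their endpoints, i.e. about at most two vertices
   in addition to [v]: this is why rank 2 is enough. *)
Lemma connect_port_val (G H : graph) (p : 'I_k -> G) (q : 'I_k -> H) j
    (v : 'I_j -> G) (w : 'I_j -> H) x y Z :
  injective p -> injective q -> same_ports p q ->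
  (forall i, v i \notin port_set p) -> (forall i, w i \notin port_set q) ->
  type p (~: port_set p) 2 v = type q (~: port_set q) 2 w ->
  port_val p v x \notin map (port_val p v) Z ->
  connect (avoid [set z in map (port_val p v) Z]) (port_val p v x) (port_val p v y) ->
  connect (avoid [set z in map (port_val q w) Z]) (port_val q w x) (port_val q w y).
Proof.
move=> p_inj q_inj pq vP wP e2 xZ.
set B := [set z in map (port_val p v) Z]; set B' := [set z in map (port_val q w) Z].
have e0 := type_atomic e2; have /atomic_typeP a0 := e0.
have BB' z : (port_val p v z \in B) = (port_val q w z \in B').
  by rewrite !inE (port_val_mem p_inj q_inj vP wP e0).
(* [B] blocks the ports and chosen vertices in Z; [bl] blocks the same chosen vertices but every
   port, as the atoms do. *)
pose ZV := [set i | inr i \in Z].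
pose bl := blocked p v ZV; pose bl' := blocked q w ZV.
have blB u : u \notin B -> u \notin port_set p -> u \notin bl.
  move=> uB uP; rewrite in_setU (negbTE uP) /=; apply: contra uB.
  by case/imsetP=> i; rewrite !inE => iZ ->; apply/mapP; exists (inr i).
have blB' u : u \notin bl' -> u \notin B'.
  rewrite in_setU negb_or => /andP[uP uV]; apply/negP; rewrite inE => /mapP[[i|i] iZ ui].
    by rewrite ui mem_port_set in uP.
  by move: uV; rewrite ui /= imset_f // inE.
have sub' u1 u2 : connect (avoid bl') u1 u2 -> connect (avoid B') u1 u2.
  apply: connect_sub => s t /and3P[st sb tb]; apply: connect1.
  by rewrite /avoid st !blB'.
have newB u u' : u' \notin port_set q -> (forall l, (v l == u) = (w l == u')) ->
    u \notin B -> u' \notin B'.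
  move=> uQ ul; apply: contra; rewrite inE => /mapP[[l|l] lZ ul'].
    by rewrite ul' mem_port_set in uQ.
  by move: (ul l); rewrite ul' eqxx => /eqP <-; rewrite (BB' (inr l)) inE map_f.
(* One round: a counterpart of u with the same neighbours among the ports and the same connections
   to the chosen vertices. *)
have ext1 u : u \notin port_set p -> u \notin B -> exists u',
    [/\ u' \notin B', forall i, edge u (p i) = edge u' (q i)
      & forall a, connect (avoid bl) (v a) u = connect (avoid bl') (w a) u'].
  move=> uP uB; have [|u' u'Q /type_atomic/atomic_typeP e] := type_forth (type_leq (leqnSn 1) e2) (a := u).
    by rewrite inE.
  rewrite inE in u'Q; exists u'; split.
  - apply: newB uB => // l; have := e (inl (inl (inl (lift ord_max l, ord_max)))).
    by rewrite /= !snoc_max !snoc_lift.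
  - by move=> i; have := e (inl (inr (ord_max, i))); rewrite /= !snoc_max.
  - move=> a; have := e (inr (lift ord_max a, ord_max, lift ord_max @: ZV)).
    by rewrite /= !snoc_max !snoc_lift !blocked_lift.
(* Two rounds: a piece of path between two ports is seen through its end vertices c and u. *)
have ext2 u c : u \notin port_set p -> u \notin B -> c \notin port_set p -> c \notin B ->
    exists u' c', [/\ u' \notin B', c' \notin B', forall i, edge u (p i) = edge u' (q i),
      forall i, edge c (p i) = edge c' (q i)
      & connect (avoid bl) c u = connect (avoid bl') c' u'].
  move=> uP uB cP cB.
  have [|u' u'Q e1] := type_forth e2 (a := u); first by rewrite inE.
  have [|c' c'Q /type_atomic/atomic_typeP e] := type_forth e1 (a := c); first by rewrite inE.
  rewrite inE in u'Q; rewrite inE in c'Q; exists u', c'; split.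
  - apply: newB uB => // l; have := e (inl (inl (inl (lift ord_max (lift ord_max l), lift ord_max ord_max)))).
    by rewrite /= !snoc_lift !snoc_max.
  - apply: newB cB => // l; have := e (inl (inl (inl (lift ord_max (lift ord_max l), ord_max)))).
    by rewrite /= !snoc_max !snoc_lift.
  - by move=> i; have := e (inl (inr (lift ord_max ord_max, i))); rewrite /= !snoc_lift !snoc_max.
  - by move=> i; have := e (inl (inr (ord_max, i))); rewrite /= !snoc_max.
  - have := e (inr (ord_max, lift ord_max ord_max, lift ord_max @: (lift ord_max @: ZV))).
    by rewrite /= !snoc_max !snoc_lift !blocked_lift !snoc_max.
(* How a vertex off the ports is reached after the last port of the path: straight from x, which is
   then a chosen vertex, or from a neighbour c of a port whose counterpart is already known to be
   reached in H. *)
pose anchor u := (exists a, x = inr a /\ connect (avoid bl) (v a) u) \/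
  (exists i c, [/\ connect (avoid B') (port_val q w x) (q i) /\ q i \notin B',
     edge c (p i), c \notin port_set p, c \notin B & connect (avoid bl) c u]).
suff main u : connect (avoid B) (port_val p v x) u ->
    (forall i, u = p i -> connect (avoid B') (port_val q w x) (q i)) /\
    (u \notin port_set p -> anchor u).
  case: y => [i|a] /main[h1 h2] /=; first exact: h1.
  case: (h2 (vP a)) => [[b [xb cb]]|[i [c [[xi iB] ci cP cB cu]]]].
    apply: sub'; rewrite xb /=; have := a0 (inr (b, a, ZV)).
    by rewrite /= -/bl -/bl' => <-.
  have [c' [c'B c'i c'a]] := ext1 c cP cB.
  apply: connect_trans xi _; apply: (@connect_trans _ _ c').
    by apply: connect1; rewrite /avoid edge_sym -c'i ci iB c'B.
  apply: sub'; rewrite avoid_connect_sym -c'a avoid_connect_sym.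
  exact: cu.
move: u; apply: connect_ind.
  split=> [i xi|xP].
    suff /eqP -> : port_val q w x == port_val q w (inl i) by exact: connect0.
    by rewrite -(port_val_eq p_inj q_inj vP wP e0) xi.
  left; case: (x) xP => [i|a]; first by rewrite mem_port_set.
  by exists a; rewrite connect0.
move=> y1 y2 _ [h1 h2] /and3P[y12 y1B y2B]; split=> [l y2l|y2P].
  have lB : q l \notin B' by rewrite -(BB' (inl l)) /= -y2l.
  case: (boolP (y1 \in port_set p)) => [/port_setP[i y1i]|y1P].
    apply: connect_trans (h1 i y1i) _; apply: connect1.
    by rewrite /avoid lB -pq -y1i -y2l y12 -(BB' (inl i)) /= -y1i y1B.
  rewrite y2l in y12.
  case: (h2 y1P) => [[b [xb cb]]|[i [c [[xi iB] ci cP cB cu]]]].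
    have [c' [c'B c'i c'a]] := ext1 y1 y1P y1B.
    apply: (@connect_trans _ _ c'); last first.
      by apply: connect1; rewrite /avoid -c'i y12 lB c'B.
    by apply: sub'; rewrite xb /= -c'a.
  have [y1' [c' [y1B' c'B y1i' c'i c'y1]]] := ext2 y1 c y1P y1B cP cB.
  apply: connect_trans xi _; apply: (@connect_trans _ _ c').
    by apply: connect1; rewrite /avoid edge_sym -c'i ci iB c'B.
  apply: (@connect_trans _ _ y1'); first by apply: sub'; rewrite -c'y1.
  by apply: connect1; rewrite /avoid -y1i' y12 lB y1B'.
case: (boolP (y1 \in port_set p)) => [/port_setP[i y1i]|y1P].
  right; exists i, y2; rewrite connect0 edge_sym -y1i y12; split=> //.
  by split; [exact: h1|rewrite -(BB' (inl i)) /= -y1i].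
have cy : connect (avoid bl) y1 y2.
  by apply: connect1; rewrite /avoid y12 !blB.
case: (h2 y1P) => [[b [xb cb]]|[i [c [h ci cP cB cu]]]].
  by left; exists b; split=> //; apply: connect_trans cb cy.
by right; exists i, c; split=> //; apply: connect_trans cu cy.
Qed.

(** Separation weighs 2 because it is not an atom of the game; [connect_port_val] recovers it from
    types of rank 2. *)
Fixpoint rank l (phi : formula l) : nat :=
  match phi with
  | FEq _ _ _ => 0
  | FEdge _ _ _ => 0
  | FSep _ _ _ _ _ => 2
  | FNot _ phi => rank phi
  | FAnd _ phi psi => maxn (rank phi) (rank psi)
  | FOr _ phi psi => maxn (rank phi) (rank psi)
  | FEx _ phi => (rank phi).+1
  | FAll _ phi => (rank phi).+1
  end.

Lemma port_val_snoc (G : graph) (p : 'I_k -> G) j (v : 'I_j -> G) a l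
    (r : 'I_l -> 'I_k + 'I_j) :
  snoc (port_val p v \o r) a = port_val p (snoc v a) \o
    snoc (fun i => match r i with inl x => inl x | inr y => inr (lift ord_max y) end)
      (inr ord_max).
Proof.
rewrite comp_snoc /= snoc_max; congr snoc.
apply: functional_extensionality => i /=; case: (r i) => //= x.
by rewrite snoc_lift.
Qed.

Lemma port_val_snoc_port (G : graph) (p : 'I_k -> G) j (v : 'I_j -> G) i l
    (r : 'I_l -> 'I_k + 'I_j) :
  snoc (port_val p v \o r) (p i) = port_val p v \o snoc r (inl i).
Proof. by rewrite comp_snoc. Qed.

Lemma snoc_notin (G : graph) (P : {set G}) j (v : 'I_j -> G) a :
  (forall i, v i \notin P) -> a \notin P -> forall i, snoc v a i \notin P.
Proof. by move=> vP aP i; rewrite /snoc; case: unlift. Qed.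

(** A port is answered by the port of the same number, which leaves the chosen vertices unchanged;
    any other vertex is answered by a round of the game. *)
Lemma sat_type_forth l (phi : formula l.+1) n (G H : graph) (p : 'I_k -> G)
    (q : 'I_k -> H) j (v : 'I_j -> G) (w : 'I_j -> H) r :
  (forall j' (v' : 'I_j' -> G) (w' : 'I_j' -> H) r',
     (forall i, v' i \notin port_set p) -> (forall i, w' i \notin port_set q) ->
     type p (~: port_set p) n v' = type q (~: port_set q) n w' ->
     sat phi (port_val p v' \o r') <-> sat phi (port_val q w' \o r')) ->
  (forall i, v i \notin port_set p) -> (forall i, w i \notin port_set q) ->
  type p (~: port_set p) n.+1 v = type q (~: port_set q) n.+1 w ->
  forall a, exists b, sat phi (snoc (port_val p v \o r) a) <->
                      sat phi (snoc (port_val q w \o r) b).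
Proof.
move=> IH vP wP e a; case: (boolP (a \in port_set p)) => [/port_setP[i ->]|aP].
  exists (q i); rewrite !port_val_snoc_port.
  by apply: IH => //; apply: type_leq e.
have [|b bQ eb] := type_forth e (a := a); first by rewrite inE.
rewrite inE in bQ; exists b; rewrite !port_val_snoc.
by apply: IH => //; apply: snoc_notin.
Qed.

Lemma sat_type l (phi : formula l) (G H : graph) (p : 'I_k -> G) (q : 'I_k -> H) j
    (v : 'I_j -> G) (w : 'I_j -> H) r :
  injective p -> injective q -> same_ports p q ->
  (forall i, v i \notin port_set p) -> (forall i, w i \notin port_set q) ->
  type p (~: port_set p) (rank phi) v = type q (~: port_set q) (rank phi) w ->
  sat phi (port_val p v \o r) <-> sat phi (port_val q w \o r).
Proof.
move=> p_inj q_inj pq.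
elim: phi j v w r => {l}
  [l x y|l x y|l n x y z|l phi IH|l phi IH psi IH'|l phi IH psi IH'|l phi IH|l phi IH]
  j v w r vP wP e /=.
- have h := port_val_eq p_inj q_inj vP wP e.
  by split=> /eqP h'; apply/eqP; move: h'; rewrite h.
- by rewrite (port_val_edge pq e).
- have e0 := type_atomic e.
  have qp : same_ports q p by move=> i i'; rewrite pq.
  rewrite !separatesP !(map_comp (port_val _ _) r) (port_val_mem p_inj q_inj vP wP e0).
  case xZ: (_ \in _) => //=.
  have xZ' : port_val p v (r x) \notin map (port_val p v) (map r z).
    by rewrite (port_val_mem p_inj q_inj vP wP e0) xZ.
  have h1 := connect_port_val p_inj q_inj pq vP wP e xZ'.
  have h2 := connect_port_val q_inj p_inj qp wP vP (esym e) (negbT xZ).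
  by split; apply: contra; [apply: h2|apply: h1].
- by rewrite (IH _ _ _ _ vP wP e).
- rewrite (IH _ _ _ _ vP wP (type_leq (leq_maxl _ _) e)).
  by rewrite (IH' _ _ _ _ vP wP (type_leq (leq_maxr _ _) e)).
- rewrite (IH _ _ _ _ vP wP (type_leq (leq_maxl _ _) e)).
  by rewrite (IH' _ _ _ _ vP wP (type_leq (leq_maxr _ _) e)).
- have forth := sat_type_forth r IH vP wP e.
  have back := sat_type_forth r (fun j' v' w' r' wP' vP' e' =>
    iff_sym (IH j' w' v' r' vP' wP' (esym e'))) wP vP (esym e).
  by split=> -[a ha]; [have [b hb] := forth a|have [b hb] := back a]; exists b;
    apply/hb.
- have forth := sat_type_forth r IH vP wP e.
  have back := sat_type_forth r (fun j' v' w' r' wP' vP' e' =>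
    iff_sym (IH j' w' v' r' vP' wP' (esym e'))) wP vP (esym e).
  by split=> ha a; [have [b hb] := back a|have [b hb] := forth a]; apply/hb.
Qed.

(** * Components *)

Section Components.
Variables (G : graph) (p : 'I_k -> G).
Local Notation conn := (connect (avoid (port_set p))).

Definition component x : {set G} := [set y | conn x y].

(** Equivalently, D is a union of components of the graph without its ports. *)
Definition off_ports_closed (D : {set G}) : Prop :=
  (forall x, x \in D -> x \notin port_set p) /\
  (forall x y, x \in D -> edge x y -> y \notin port_set p -> y \in D).

Lemma mem_component x : x \in component x.
Proof. by rewrite inE connect0. Qed.

Lemma component_eq x y : y \in component x -> component y = component x.
Proof.
rewrite inE => xy; apply/setP => z.
by rewrite !inE (same_connect (@avoid_connect_sym _ _) xy).
Qed.

Lemma component_sym x y : (y \in component x) = (x \in component y).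
Proof. by rewrite !inE avoid_connect_sym. Qed.

Lemma component_closed x : x \notin port_set p -> off_ports_closed (component x).
Proof.
move=> xP; have cP y : y \in component x -> y \notin port_set p.
  by rewrite inE => /connect_avoid_notin; apply.
split=> // y z yx yz zP; move: (yx); rewrite !inE => xy.
by apply: connect_trans xy _; apply: connect1; rewrite /avoid yz zP cP.
Qed.

Lemma nonports_closed : off_ports_closed (~: port_set p).
Proof. by split=> [x|x y _ _]; rewrite inE. Qed.

Lemma offC_closed D : off_ports_closed D -> off_ports_closed (~: (D :|: port_set p)).
Proof.
move=> [DP Dc]; split=> [x|x y]; first by rewrite !inE negb_or => /andP[].
rewrite !in_setC !in_setU !negb_or => /andP[xD xP] xy yP; rewrite yP andbT.
by apply: contra xD => yD; apply: Dc yD _ xP; rewrite edge_sym.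
Qed.

Lemma connect_closed D (B : {set G}) x y : off_ports_closed D -> port_set p \subset B ->
  x \in D -> connect (avoid B) x y -> y \in D.
Proof.
move=> [DP Dc] /subsetP PB xD; move: y; apply: connect_ind => // u z _ uD /and3P[uz _ zB].
by apply: Dc uz _ => //; apply: contra zB; apply: PB.
Qed.

Lemma component_sub D x : off_ports_closed D -> x \in D -> component x \subset D.
Proof.
move=> cD xD; apply/subsetP => y; rewrite inE.
exact: connect_closed cD (subxx _) xD.
Qed.

(** With the ports blocked, a path that starts in D stays in D, so blocked vertices outside D have
    no effect. The map h lists at least the chosen vertices in D. *)
Lemma connect_blocked D j m (h : 'I_j -> 'I_m) (v : 'I_m -> G) Z x y :
  off_ports_closed D -> (forall i, v i \in D -> exists l, i = h l) -> x \in D ->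
  connect (avoid (blocked p v Z)) x y =
  connect (avoid (blocked p (v \o h) (h @^-1: Z))) x y.
Proof.
move=> cD hD xD.
have local (B B' : {set G}) : port_set p \subset B -> (forall z, z \in D -> z \in B' -> z \in B) ->
    connect (avoid B) x y -> connect (avoid B') x y.
  move=> PB BB'; move: y; apply: connect_ind => // u z xu xu' /and3P[uz uB zB].
  have uD := connect_closed cD PB xD xu.
  have zD : z \in D by apply: (proj2 cD u) => //; apply: contra zB; apply: (subsetP PB).
  apply: connect_trans xu' _; apply: connect1; rewrite /avoid uz /=.
  by apply/andP; split; [apply: contra uB|apply: contra zB]; apply: BB'.
apply/idP/idP; apply: local; rewrite ?subsetUl // => z zD;
  rewrite !in_setU (negbTE (proj1 cD z zD)) /= => /imsetP[i].
- by rewrite inE => iZ ->; apply/imsetP; exists (h i).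
- move=> iZ zi; have [|l il] := hD i; first by rewrite -zi.
  by apply/imsetP; exists l; rewrite ?inE -?il // /= -il.
Qed.

End Components.

Lemma holds_conn (G H : graph) (p : 'I_k -> G) (q : 'I_k -> H) j
    (v : 'I_j -> G) (w : 'I_j -> H) i l :
  atomic_type p v = atomic_type q w ->
  (v i \in component p (v l)) = (w i \in component q (w l)).
Proof.
move=> /atomic_typeP/(_ (inr (l, i, set0))).
by rewrite /= !blocked0 !inE.
Qed.

(** * Independence of a union of components from the rest *)

Section Extend.
Variables (G H : graph) (p : 'I_k -> G) (q : 'I_k -> H) (D : {set G}) (F : {set H}).
Hypotheses (D_closed : off_ports_closed p D) (F_closed : off_ports_closed q F).

(** An atom between D and the rest is false in both graphs, as no equality, edge or connection off
    the ports crosses. An atom inside D is one of the subtuple extended by a; an atom outside D does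
    not involve a and is one of v. *)
Lemma atomic_type_extend j m (f : 'I_j -> 'I_m) (v : 'I_m -> G) (w : 'I_m -> H) a b :
  (forall i, v i \notin port_set p) -> (forall i, w i \notin port_set q) ->
  atomic_type p v = atomic_type q w ->
  (forall i, (v i \in D) = (w i \in F)) ->
  (forall i, v i \in D -> exists l, i = f l) ->
  a \in D -> b \in F ->
  atomic_type p (snoc (v \o f) a) = atomic_type q (snoc (w \o f) b) ->
  atomic_type p (snoc v a) = atomic_type q (snoc w b).
Proof.
move=> vP wP /atomic_typeP e vw fD aD bF /atomic_typeP ef.
have vP' : forall i, snoc v a i \notin port_set p.
  by apply: snoc_notin => //; apply: (proj1 D_closed).
have wP' : forall i, snoc w b i \notin port_set q.
  by apply: snoc_notin => //; apply: (proj1 F_closed).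
have vw' i : (snoc v a i \in D) = (snoc w b i \in F).
  by rewrite /snoc; case: unlift => //; rewrite aD bF.
have rng i : snoc v a i \in D -> exists l, i = lift_var f l.
  case: (unliftP ord_max i) => [i' ->|->].
    by rewrite snoc_lift => /fD[l ->]; exists (lift ord_max l); rewrite /lift_var snoc_lift.
  by exists ord_max; rewrite /lift_var snoc_max.
have rng' i : snoc w b i \in F -> exists l, i = lift_var f l by rewrite -vw'; apply: rng.
have old i : snoc v a i \notin D -> exists l, i = lift ord_max l.
  by case: (unliftP ord_max i) => [i' ->|->]; [exists i'|rewrite snoc_max aD].
have cl l : snoc v a (lift_var f l) = snoc (v \o f) a l.
  by rewrite -comp_lift_var.
have cl' l : snoc w b (lift_var f l) = snoc (w \o f) b l.
  by rewrite -comp_lift_var.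
have cC := offC_closed D_closed; have cC' := offC_closed F_closed.
apply/atomic_typeP => -[[[[i1 i2]|[i1 i2]]|[i1 i]]|[[i1 i2] Z]] /=.
- case D1: (snoc v a i1 \in D); case D2: (snoc v a i2 \in D).
  + have [l1 ->] := rng _ D1; have [l2 ->] := rng _ D2; rewrite !cl !cl'.
    exact: (ef (inl (inl (inl (l1, l2))))).
  + have D1' := D1; have D2' := D2; rewrite !vw' in D1' D2'.
    apply/eqP/eqP => e'; first by rewrite e' D2 in D1.
    by rewrite e' D2' in D1'.
  + have D1' := D1; have D2' := D2; rewrite !vw' in D1' D2'.
    apply/eqP/eqP => e'; first by rewrite e' D2 in D1.
    by rewrite e' D2' in D1'.
  + have [l1 ->] := old _ (negbT D1); have [l2 ->] := old _ (negbT D2).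
    rewrite !snoc_lift; exact: (e (inl (inl (inl (l1, l2))))).
- case D1: (snoc v a i1 \in D); case D2: (snoc v a i2 \in D).
  + have [l1 ->] := rng _ D1; have [l2 ->] := rng _ D2; rewrite !cl !cl'.
    exact: (ef (inl (inl (inr (l1, l2))))).
  + have D1' := D1; have D2' := D2; rewrite !vw' in D1' D2'.
    apply/idP/idP => e'.
      by rewrite (proj2 D_closed _ _ D1 e') in D2.
    by rewrite (proj2 F_closed _ _ D1' e') in D2'.
  + have D1' := D1; have D2' := D2; rewrite !vw' in D1' D2'.
    rewrite edge_sym [RHS]edge_sym; apply/idP/idP => e'.
      by rewrite (proj2 D_closed _ _ D2 e') in D1.
    by rewrite (proj2 F_closed _ _ D2' e') in D1'.
  + have [l1 ->] := old _ (negbT D1); have [l2 ->] := old _ (negbT D2).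
    rewrite !snoc_lift; exact: (e (inl (inl (inr (l1, l2))))).
- case D1: (snoc v a i1 \in D).
  + have [l1 ->] := rng _ D1; rewrite !cl !cl'; exact: (ef (inl (inr (l1, i)))).
  + have [l1 ->] := old _ (negbT D1); rewrite !snoc_lift.
    exact: (e (inl (inr (l1, i)))).
- case D1: (snoc v a i1 \in D).
    have D1' := D1; rewrite vw' in D1'.
    case D2: (snoc v a i2 \in D).
      rewrite (connect_blocked (h := lift_var f) _ _ D_closed) //.
      rewrite (connect_blocked (h := lift_var f) _ _ F_closed) //.
      have [l1 ->] := rng _ D1; have [l2 ->] := rng _ D2; rewrite !cl !cl' !comp_lift_var.
      exact: (ef (inr (l1, l2, _))).
    have D2' := D2; rewrite vw' in D2'.
    apply/idP/idP => e'.
      by rewrite (connect_closed D_closed _ D1 e') ?subsetUl in D2.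
    by rewrite (connect_closed F_closed _ D1' e') ?subsetUl in D2'.
  have D1' := D1; rewrite vw' in D1'.
  case D2: (snoc v a i2 \in D).
    have D2' := D2; rewrite vw' in D2'.
    rewrite avoid_connect_sym [RHS]avoid_connect_sym; apply/idP/idP => e'.
      by rewrite (connect_closed D_closed _ D2 e') ?subsetUl in D1.
    by rewrite (connect_closed F_closed _ D2' e') ?subsetUl in D1'.
  have [l1 l1E] := old _ (negbT D1); have [l2 l2E] := old _ (negbT D2).
  rewrite (connect_blocked (h := lift ord_max) _ _ cC); first last.
  + by rewrite in_setC in_setU negb_or D1 vP'.
  + by move=> i; rewrite in_setC in_setU negb_or => /andP[/old].
  rewrite (connect_blocked (h := lift ord_max) _ _ cC'); first last.
  + by rewrite in_setC in_setU negb_or D1' wP'.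
  + by move=> i; rewrite in_setC in_setU negb_or -vw' => /andP[/old].
  rewrite !snoc_comp_lift l1E l2E !snoc_lift; exact: (e (inr (l1, l2, _))).
Qed.

End Extend.

(** Vertices chosen outside D do not influence the game on D, so it suffices to compare subtuples
    [v \o f] that contain every chosen vertex in D. *)
Lemma type_extend (G H : graph) (p : 'I_k -> G) (q : 'I_k -> H) D F n j m
    (f : 'I_j -> 'I_m) (v : 'I_m -> G) (w : 'I_m -> H) :
  off_ports_closed p D -> off_ports_closed q F ->
  (forall i, v i \notin port_set p) -> (forall i, w i \notin port_set q) ->
  atomic_type p v = atomic_type q w ->
  (forall i, (v i \in D) = (w i \in F)) ->
  (forall i, v i \in D -> exists l, i = f l) ->
  type p D n (v \o f) = type q F n (w \o f) -> type p D n v = type q F n w.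
Proof.
move=> cD cF; elim: n j m f v w => [|n IH] j m f v w vP wP at_eq vw rng e //.
have key a b : a \in D -> b \in F ->
    type p D n (snoc (v \o f) a) = type q F n (snoc (w \o f) b) ->
    type p D n (snoc v a) = type q F n (snoc w b).
  move=> aD bF eab; apply: (IH _ _ (lift_var f)).
  - by apply: snoc_notin => //; apply: (proj1 cD).
  - by apply: snoc_notin => //; apply: (proj1 cF).
  - by apply: (atomic_type_extend cD cF vP wP at_eq vw rng) => //; apply: type_atomic eab.
  - by move=> i; rewrite /snoc; case: unlift => //; rewrite aD bF.
  - move=> i; case: (unliftP ord_max i) => [i' ->|->].
      by rewrite snoc_lift => /rng[l ->]; exists (lift ord_max l); rewrite /lift_var snoc_lift.
    by exists ord_max; rewrite /lift_var snoc_max.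
  - by rewrite !comp_lift_var.
apply: typeS_intro => // [a aD|b bF].
  by have [b bF eab] := type_forth e aD; exists b => //; apply: key.
by have [a aD eab] := type_back e bF; exists a => //; apply: key.
Qed.


(** * The game on counts of components *)

Section Counting.
Variable N : nat.

(* Each component is represented by its root. *)
Definition free_roots (G : graph) (p : 'I_k -> G) (U : {set G}) (t : ty N 0) j
    (v : 'I_j -> G) : {set G} :=
  [set r in U | [&& root (avoid (port_set p)) r == r,
     type p (component p r) N (no_val G) == t
   & [forall i, v i \notin component p r]]].

Section Roots.
Variables (G : graph) (p : 'I_k -> G) (U : {set G}).
Hypothesis U_closed : off_ports_closed p U.
Variables (t : ty N 0) (j : nat).
Implicit Type v : 'I_j -> G.
Local Notation rt := (root (avoid (port_set p))).

Lemma component_root x : component p (rt x) = component p x.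
Proof. by apply: component_eq; rewrite inE connect_root. Qed.

Lemma mem_free_roots v x : x \in U ->
  (rt x \in free_roots p U t v) =
  (type p (component p x) N (no_val G) == t) && [forall i, v i \notin component p x].
Proof.
move=> xU; rewrite inE component_root.
have -> : rt x \in U.
  by apply: (subsetP (component_sub U_closed xU)); rewrite inE connect_root.
by rewrite root_root ?eqxx //; apply: avoid_connect_sym.
Qed.

Lemma free_roots_snoc v x : free_roots p U t (snoc v x) = free_roots p U t v :\ rt x.
Proof.
apply/setP => r; rewrite !inE.
case: (r \in U); rewrite ?andbF //=.
case: (altP (rt r =P r)) => [rr|]; rewrite ?andbF //=.
case: eqP; rewrite ?andbF //= => _.
have -> : (r != rt x) = (x \notin component p r).
  rewrite inE -(root_connect (@avoid_connect_sym _ _)) rr //.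
apply/forallP/andP => [h|[xr /forallP h] i].
  split; first by have := h ord_max; rewrite snoc_max.
  by apply/forallP => i; have := h (lift ord_max i); rewrite snoc_lift.
by rewrite /snoc; case: unlift.
Qed.

Lemma card_free_roots_snoc v x : x \in U ->
  #|free_roots p U t (snoc v x)| = #|free_roots p U t v| -
    ((type p (component p x) N (no_val G) == t) && [forall i, v i \notin component p x]).
Proof.
by move=> xU; rewrite free_roots_snoc -(mem_free_roots v) // [in RHS](cardsD1 (rt x)) addKn.
Qed.

End Roots.

Section Game.
Variables (G H : graph) (p : 'I_k -> G) (q : 'I_k -> H) (U : {set G}) (W : {set H}).
Hypotheses (U_closed : off_ports_closed p U) (W_closed : off_ports_closed q W).

(* The invariant of the Ehrenfeucht-Fraisse game between [U] and [W]. *)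
Definition matched n j (v : 'I_j -> G) (w : 'I_j -> H) : Prop :=
  [/\ (forall i, v i \in U) /\ (forall i, w i \in W),
      atomic_type p v = atomic_type q w,
      forall i, type p (component p (v i)) n v = type q (component q (w i)) n w
    & forall t, minn n #|free_roots p U t v| = minn n #|free_roots q W t w|].

(** A move in a component already visited is answered in the corresponding one, a move in a fresh
    component in a fresh component of the same type, which the counts provide. Each count drops by
    one on both sides or on neither, so agreement up to [n.+1] leaves agreement up to n. *)
Lemma matched_step n j (v : 'I_j -> G) (w : 'I_j -> H) a :
  n < N -> matched n.+1 v w -> a \in U ->
  exists2 b, b \in W & matched n (snoc v a) (snoc w b).
Proof.
move=> nN [[vU wW] at_eq tys cnt] aU.
have vP i : v i \notin port_set p by apply: (proj1 U_closed).
have wP i : w i \notin port_set q by apply: (proj1 W_closed).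
have aP : a \notin port_set p by apply: (proj1 U_closed).
(* The component of the answer is found before the answer itself: c is a vertex of it, and b will
   come from a round played inside. *)
have [c [cW ec vw cc]] : exists c, [/\ c \in W,
    type p (component p a) n.+1 v = type q (component q c) n.+1 w,
    forall i, (v i \in component p a) = (w i \in component q c)
  & forall t, minn n #|free_roots p U t (snoc v a)| = minn n #|free_roots q W t (snoc w c)|].
  case: (boolP [exists i, v i \in component p a]) => [/existsP[i via]|].
    have eqa := component_eq via.
    exists (w i); split=> //; first by rewrite -eqa.
      by move=> l; rewrite -eqa; apply: holds_conn.
    move=> t; rewrite !card_free_roots_snoc //.
    have -> : [forall l, v l \notin component p a] = false.
      by apply/forallP => /(_ i); rewrite via.
    have -> : [forall l, w l \notin component q (w i)] = false.
      by apply/forallP => /(_ i); rewrite mem_component.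
    by rewrite !andbF !subn0; have := cnt t; lia.
  rewrite negb_exists => nva.
  pose t0 := type p (component p a) N (no_val G).
  have ra : root (avoid (port_set p)) a \in free_roots p U t0 v.
    by rewrite mem_free_roots // eqxx.
  have /card_gt0P[c cR] : 0 < #|free_roots q W t0 w|.
    by have := cnt t0; rewrite (cardsD1 (root (avoid (port_set p)) a) (free_roots p U t0 v)) ra; lia.
  have := cR; rewrite inE => /and4P[cW /eqP rc /eqP tc /forallP nwc].
  exists c; split=> //.
  - have vw i : (v i \in component p a) = (w i \in component q c).
      by rewrite (negbTE (nwc i)); apply/negbTE; apply: (forallP nva).
    (* The fresh components contain no chosen vertex, so the empty subtuple is enough to compare
       their types over v and w. *)
    apply: (type_extend (f := fun i : 'I_0 => no_val 'I_j i)) => //.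
    + exact: component_closed.
    + by apply: component_closed; apply: (proj1 W_closed).
    + by move=> i; rewrite (negbTE (forallP nva i)).
    + rewrite (val0_eq (v \o _) (no_val G)) (val0_eq (w \o _) (no_val H)).
      by apply: (type_leq nN).
  - by move=> i; rewrite (negbTE (nwc i)); apply/negbTE; apply: (forallP nva).
  - move=> t; rewrite !card_free_roots_snoc // nva tc -/t0.
    have -> : [forall i, w i \notin component q c] by apply/forallP.
    rewrite andbT; case: (altP (t0 =P t)) => [<-|_]; last by have := cnt t; rewrite !subn0; lia.
    have /card_gt0P h1 : exists r, r \in free_roots p U t0 v by eexists; apply: ra.
    have /card_gt0P h2 : exists r, r \in free_roots q W t0 w by eexists; apply: cR.
    by have := cnt t0; lia.
have [b bc eb] := type_forth ec (mem_component p a).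
have cP : c \notin port_set q by apply: (proj1 W_closed).
have bW : b \in W by apply: (subsetP (component_sub W_closed cW)).
have cb : component q b = component q c by apply: component_eq.
exists b => //; split.
- by split=> i; rewrite /snoc; case: unlift.
- exact: type_atomic eb.
- have at_eq' := type_atomic eb.
  move=> i; case: (unliftP ord_max i) => [l ->|->]; last by rewrite !snoc_max cb.
  rewrite !snoc_lift; case vl: (v l \in component p a).
    rewrite (component_eq vl) (component_eq (x := c)) //.
    by rewrite -vw.
  have al : a \notin component p (v l) by rewrite component_sym vl.
  have bl : b \notin component q (w l).
    by have := holds_conn ord_max (lift ord_max l) at_eq'; rewrite !snoc_max !snoc_lift (negbTE al) => <-.
  (* Here a and b lie outside the components of [v l] and [w l], so the types of these survive the
     move. *)
  apply: (type_extend (f := lift ord_max)) => //.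
  + exact: component_closed.
  + exact: component_closed.
  + exact: snoc_notin.
  + by apply: snoc_notin => //; apply: (proj1 W_closed).
  + by move=> i'; have := holds_conn i' (lift ord_max l) at_eq'; rewrite !snoc_lift.
  + move=> i'; case: (unliftP ord_max i') => [l' ->|->]; first by exists l'.
    by rewrite snoc_max (negbTE al).
  + by rewrite !snoc_comp_lift; apply: (type_leq (leqnSn n)).
- move=> t; rewrite cc !card_free_roots_snoc //.
  by rewrite cb.
Qed.

End Game.

Lemma matched_sym (G H : graph) (p : 'I_k -> G) (q : 'I_k -> H) U W n j
    (v : 'I_j -> G) (w : 'I_j -> H) :
  matched p q U W n v w -> matched q p W U n w v.
Proof.
by move=> [[h1 h2] h3 h4 h5]; split=> // *; symmetry.
Qed.

Lemma matched_type (G H : graph) (p : 'I_k -> G) (q : 'I_k -> H) U W n j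
    (v : 'I_j -> G) (w : 'I_j -> H) :
  off_ports_closed p U -> off_ports_closed q W -> n <= N ->
  matched p q U W n v w -> type p U n v = type q W n w.
Proof.
move=> cU cW; elim: n j v w => [|n IH] j v w nN m; first by case: m.
apply: typeS_intro; first by case: m.
  move=> a aU; have [b bW mb] := matched_step cU cW nN m aU.
  by exists b => //; apply: IH => //; apply: ltnW.
move=> b bW; have [a aU ma] := matched_step cW cU nN (matched_sym m) bW.
by exists a => //; apply: IH (matched_sym ma); apply: ltnW.
Qed.

(** Before any move the other clauses of [matched] are vacuous, since every atom mentions a chosen
    vertex. *)
Lemma type_of_counts (G H : graph) (p : 'I_k -> G) (q : 'I_k -> H) U W :
  off_ports_closed p U -> off_ports_closed q W ->
  (forall t, minn N #|free_roots p U t (no_val G)| = minn N #|free_roots q W t (no_val H)|) ->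
  type p U N (no_val G) = type q W N (no_val H).
Proof.
move=> cU cW cnt; apply: matched_type => //; split=> //; try by split; case.
  by apply/atomic_typeP => -[[[[i1 i2]|[i1 i2]]|[i1 i]]|[[i1 i2] Z]]; case: i1.
by case.
Qed.

(** * Counting components is definable *)

Lemma definable_connect X (f : 'I_k -> X) j (g : 'I_j -> X) (Z : {set 'I_j}) x y :
  definable (fun G w => connect (avoid (blocked (w \o f) (w \o g) Z)) (w x) (w y)).
Proof.
pose z (i : 'I_(k + #|Z|)) : X :=
  match split i with inl a => f a | inr b => g (enum_val b) end.
apply: eq_definable (definable_or (definable_eq x y)
  (definable_not (definable_separates x y z))) => G w.
rewrite connect_avoidE.
suff /eq_separates -> : map (w \o z) (enum 'I_(k + #|Z|)) =i enum (blocked (w \o f) (w \o g) Z) by [].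
move=> u; rewrite mem_enum in_setU; apply/mapP/orP.
  move=> [i _ ->]; rewrite /= /z; case: split => a; [left|right].
    exact: mem_port_set.
  by apply/imsetP; exists (enum_val a) => //; apply: enum_valP.
case=> [/port_setP[i ->]|/imsetP[i iZ ->]].
  exists (lshift #|Z| i); first by rewrite mem_enum.
  by rewrite /= /z (unsplitK (inl i)).
exists (rshift k (enum_rank_in iZ i)); first by rewrite mem_enum.
by rewrite /= /z (unsplitK (inr _)) enum_rankK_in.
Qed.

Lemma definable_holds X (f : 'I_k -> X) j (g : 'I_j -> X) (a : atom j) :
  definable (fun G w => holds (w \o f) (w \o g) a).
Proof.
case: a => [[[[i1 i2]|[i1 i2]]|[i1 i]]|[[i1 i2] Z]].
- by apply: eq_definable (definable_eq (g i1) (g i2)) => G w; split=> /eqP.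
- exact: definable_edge (g i1) (g i2).
- exact: definable_edge (g i1) (f i).
- by apply: eq_definable (definable_connect f g Z (g i1) (g i2)) => G w.
Qed.

Lemma definable_atomic_type X (f : 'I_k -> X) j (g : 'I_j -> X) t :
  definable (fun G w => atomic_type (w \o f) (w \o g) = t).
Proof.
apply: eq_definable (definable_forall (fun a =>
  definable_iff (definable_holds f g a) (definable_const X (a \in t)))) => G w.
split=> [h|<- a]; last by rewrite inE.
by apply/setP => a; rewrite inE; apply/idP/idP => /h.
Qed.

Lemma definable_component X (f : 'I_k -> X) c x :
  definable (fun G w => w x \in component (w \o f) (w c)).
Proof.
apply: eq_definable (definable_connect f (no_val X) set0 c x) => G w.
by rewrite blocked0 inE.
Qed.

(** A type of rank n + 1 is fixed by an atomic type and by which of the finitely many types of rank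
    n occur. The induction needs X arbitrary, as each quantifier adds the variable [None]. *)
Lemma definable_component_type X (f : 'I_k -> X) c n j (g : 'I_j -> X) (t : ty n j) :
  definable (fun G w => type (w \o f) (component (w \o f) (w c)) n (w \o g) = t).
Proof.
elim: n X f c j g t => [|n IH] X f c j g t; first exact: definable_atomic_type.
pose g' : 'I_j.+1 -> option X := snoc (Some \o g) None.
have dex s : definable (fun G (w : X -> G) => exists a,
    a \in component (w \o f) (w c) /\
    type (w \o f) (component (w \o f) (w c)) n (snoc (w \o g) a) = s).
  have := definable_ex (definable_and
    (definable_component (Some \o f) (Some c) None)
    (IH (option X) (Some \o f) (Some c) j.+1 g' s)).
  apply: eq_definable => G w.
  have gE a : oapp w a \o g' = snoc (w \o g) a by rewrite comp_snoc.
  by split=> -[a [h1 h2]]; exists a; split; rewrite ?gE // -?gE.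
apply: eq_definable (definable_and (definable_atomic_type f g t.1)
  (definable_forall (fun s => definable_iff (dex s) (definable_const X (s \in t.2))))) => G w.
split=> [[e h]|<- /=].
  rewrite [t]surjective_pairing -e /=; congr pair; apply/setP => s.
  apply/imsetP/idP => [[a aC sE]|/h[a [aC sE]]]; last by exists a.
  by apply/h; exists a.
split=> // s; split=> [[a [aC <-]]|/imsetP[a aC ->]]; last by exists a.
exact: imset_f.
Qed.

(** Roots are an arbitrary choice that no formula sees, so the count is unfolded with any vertex a
    of a fresh component; choosing a removes that component from the count. *)
Lemma leq_free_roots (G : graph) (p : 'I_k -> G) t j (v : 'I_j -> G) m :
  m < #|free_roots p (~: port_set p) t v| <->
  exists a, [/\ a \notin port_set p, type p (component p a) N (no_val G) = t,
    forall i, v i \notin component p a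
  & m <= #|free_roots p (~: port_set p) t (snoc v a)|].
Proof.
have cP := nonports_closed p.
split=> [mR|[a [aP ta va]]].
  have /card_gt0P[r rR] : 0 < #|free_roots p (~: port_set p) t v| by lia.
  have := rR; rewrite inE => /and4P[rP rr /eqP tr /forallP vr]; exists r; split=> //.
    by rewrite inE in rP.
  by rewrite card_free_roots_snoc // tr eqxx; case: [forall i, _]; lia.
have aU : a \in ~: port_set p by rewrite inE.
rewrite card_free_roots_snoc // ta eqxx /=.
have -> : [forall i, v i \notin component p a] by apply/forallP.
have : root (avoid (port_set p)) a \in free_roots p (~: port_set p) t v.
  by rewrite mem_free_roots // ta eqxx; apply/forallP.
by rewrite (cardsD1 (root (avoid (port_set p)) a) (free_roots _ _ _ _)) => ->; lia.
Qed.

Lemma definable_count X (f : 'I_k -> X) t m j (g : 'I_j -> X) :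
  definable (fun G w =>
    m <= #|free_roots (w \o f) (~: port_set (w \o f)) t (w \o g)|).
Proof.
elim: m X f j g => [|m IH] X f j g.
  by apply: eq_definable (definable_true X) => G w; split.
pose g' : 'I_j.+1 -> option X := snoc (Some \o g) None.
have dP : definable (fun G (w : option X -> G) => forall i, w None <> (w \o (Some \o f)) i).
  by apply: definable_forall => i; apply: definable_not; apply: definable_eq.
have dT := @definable_component_type (option X) (Some \o f) None N 0 (no_val _) t.
have dC : definable (fun G (w : option X -> G) =>
    forall i : 'I_j, ~ (w (Some (g i)) \in component (w \o (Some \o f)) (w None))).
  apply: definable_forall => i; apply: definable_not; exact: definable_component.
have := definable_ex (definable_and (definable_and dP dT)
  (definable_and dC (IH (option X) (Some \o f) j.+1 g'))).
apply: eq_definable => G w; rewrite leq_free_roots.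
have gE a : oapp w a \o g' = snoc (w \o g) a by rewrite comp_snoc.
split=> -[a h]; exists a; move: h.
  case=> [[h1 h2] [h3 h4]]; split.
  - by apply/port_setP => -[i] /h1.
  - by rewrite (val0_eq (no_val G) (oapp w a \o no_val _)).
  - by move=> i; apply/negP/h3.
  - by rewrite -gE.
case=> h1 h2 h3 h4; split; split.
- by move=> i /= ai; case/port_setP: h1; exists i.
- by rewrite (val0_eq (_ \o no_val _) (no_val G)).
- by move=> i; apply/negP/h3.
- by rewrite gE.
Qed.

End Counting.
End Types.

(** * Definability of fusions *)

Section TypeEmbed.
Variables (k : nat) (H G : graph) (p : 'I_k -> H) (q : 'I_k -> G) (f : H -> G).
Hypotheses (f_inj : injective f) (f_port : forall i, f (p i) = q i).
Hypothesis f_edge : forall x y, x \notin port_set p -> edge (f x) (f y) = edge x y.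
Hypothesis f_closed :
  forall x z, x \notin port_set p -> edge (f x) z -> exists y, z = f y.

Lemma mem_port_set_embed x : (f x \in port_set q) = (x \in port_set p).
Proof.
apply/port_setP/port_setP => -[i]; last by move->; exists i; rewrite f_port.
by rewrite -f_port => /f_inj->; exists i.
Qed.

Lemma blocked_embed j (v : 'I_j -> H) Z x :
  (f x \in blocked q (f \o v) Z) = (x \in blocked p v Z).
Proof.
rewrite !in_setU mem_port_set_embed; congr (_ || _).
apply/imsetP/imsetP => -[i iZ]; last by move->; exists i.
by move/f_inj->; exists i.
Qed.

Lemma connect_embed j (v : 'I_j -> H) Z x y :
  connect (avoid (blocked q (f \o v) Z)) (f x) (f y) =
  connect (avoid (blocked p v Z)) x y.
Proof.
apply/idP/idP => [c|]; last first.
  move: y; apply: connect_ind => // u z _ cu /and3P[uz ub zb].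
  apply: connect_trans cu _; apply: connect1; rewrite /avoid !blocked_embed ub zb.
  by rewrite f_edge ?uz //; move: ub; rewrite in_setU negb_or => /andP[].
suff [u /f_inj-> //] : exists2 u, f y = f u & connect (avoid (blocked p v Z)) x u.
move: (f y) c; apply: connect_ind; first by exists x.
move=> _ z _ [u -> xu] /and3P[uz ub zb].
have uP : u \notin port_set p.
  by move: ub; rewrite blocked_embed in_setU negb_or => /andP[].
have [z' zE] := f_closed uP uz; exists z' => //; apply: connect_trans xu _.
by apply: connect1; rewrite /avoid -f_edge // -zE uz -!(blocked_embed v) -zE ub zb.
Qed.

(** No atom asks about an edge between two ports, and the paths in atoms avoid ports, so f may add
    edges between ports, as the inclusion of a part into a fusion does. *)
Lemma type_embed n j (v : 'I_j -> H) : (forall i, v i \notin port_set p) ->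
  type q (f @: (~: port_set p)) n (f \o v) = type p (~: port_set p) n v.
Proof.
have at_eq j' (v' : 'I_j' -> H) : (forall i, v' i \notin port_set p) ->
    atomic_type q (f \o v') = atomic_type p v'.
  move=> vP; apply/atomic_typeP => -[[[[i1 i2]|[i1 i2]]|[i1 i]]|[[i1 i2] Z]] /=.
  - by rewrite inj_eq.
  - by rewrite f_edge.
  - by rewrite -f_port f_edge.
  - exact: connect_embed.
elim: n j v => [|n IH] j v vP; first exact: at_eq.
apply: typeS_intro; first exact: at_eq.
  move=> _ /imsetP[a aP ->]; exists a => //; rewrite -comp_snoc; apply: IH.
  by apply: snoc_notin => //; rewrite inE in aP.
move=> a aP; exists (f a); first exact: imset_f.
rewrite -comp_snoc; apply: IH.
by apply: snoc_notin => //; rewrite inE in aP.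
Qed.

End TypeEmbed.

Lemma fusion_embeddings_sym k (G H K : pgraph k) (f : H -> G) (g : K -> G) :
  fusion_embeddings f g -> fusion_embeddings g f.
Proof.
move=> [[fi gi fp gp] cov meet [ef eg] efg]; split=> //.
- by move=> z; case: (cov z); [right|left].
- move=> x y e; have [i yi] := meet _ _ (esym e); exists i; apply: gi.
  by rewrite e yi fp gp.
- by move=> z z' /efg[]; [right|left].
Qed.

Section FusionSide.
Variables (k : nat) (G H K : pgraph k) (f : H -> G) (g : K -> G).
Hypothesis fg : fusion_embeddings f g.
Local Notation ports A := (port_set (port A)).

(** An edge of G at [f x] cannot come from K, whose image meets that of H only in ports. *)
Lemma fusion_side_edge x y : x \notin ports H -> edge (f x) (f y) = edge x y.
Proof.
case: fg => [[fi gi fp gp] cov meet [ef eg] efg] xP.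
apply/idP/idP => [/efg[]|/ef //] [x' [y' [e1 e2 xy]]].
  by rewrite (fi _ _ e1) (fi _ _ e2).
by have [i xi] := meet _ _ e1; rewrite xi mem_port_set in xP.
Qed.

Lemma fusion_side_closed x z : x \notin ports H -> edge (f x) z -> exists y, z = f y.
Proof.
case: fg => [[fi gi fp gp] cov meet [ef eg] efg] xP.
move=> /efg[] [x' [y' [e1 e2 xy]]]; first by exists y'.
by have [i xi] := meet _ _ e1; rewrite xi mem_port_set in xP.
Qed.

Lemma fusion_side_nonport x : (f x \in ports G) = (x \in ports H).
Proof. by case: fg => [[fi gi fp gp] _ _ _ _]; apply: mem_port_set_embed. Qed.

Lemma fusion_side_off_ports : off_ports_closed (port G) (f @: (~: ports H)).
Proof.
split=> [_ /imsetP[x xP ->]|_ z /imsetP[x xP ->] xz zP].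
  by rewrite fusion_side_nonport -in_setC.
rewrite inE in xP; have [y zy] := fusion_side_closed xP xz.
by rewrite zy imset_f // inE -fusion_side_nonport -zy.
Qed.

Lemma fusion_side_type n :
  type (port G) (f @: (~: ports H)) n (no_val G) = type (port H) (~: ports H) n (no_val H).
Proof.
case: fg => [[fi gi fp gp] _ _ _ _].
rewrite (val0_eq (no_val G) (f \o no_val H)); apply: type_embed => //.
- exact: fusion_side_edge.
- exact: fusion_side_closed.
- by case.
Qed.

Lemma fusion_side_cover : ~: ports G = (f @: (~: ports H)) :|: (g @: (~: ports K)).
Proof.
have [[fi gi fp gp] cov meet _ _] := fg.
have gP x : (g x \in ports G) = (x \in ports K) by apply: mem_port_set_embed.
apply/setP => z; rewrite in_setC in_setU; apply/idP/orP.
  case: (cov z) => -[x ->]; rewrite ?fusion_side_nonport ?gP -in_setC => xP;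
  by [left; apply: imset_f|right; apply: imset_f].
by case=> /imsetP[x xP ->]; rewrite ?fusion_side_nonport ?gP -in_setC.
Qed.

Lemma fusion_side_disjoint : [disjoint (f @: (~: ports H)) & (g @: (~: ports K))].
Proof.
have [[fi gi fp gp] cov meet _ _] := fg.
apply/pred0P => z /=; apply/negP => /andP[/imsetP[x xP ->] /imsetP[y yP /meet[i xi]]].
by move: xP; rewrite inE xi mem_port_set.
Qed.

End FusionSide.

(** * Rebuilding a part of a fusion inside another graph *)

Section SidePart.
Variables (k : nat) (G H : pgraph k) (U : {set G}).
Local Notation ports A := (port_set (port A)).

Definition side_set : {set G} := U :|: ports G.

(** Edges at a vertex off the ports are all kept, those between ports are copied from H: the part
    has to resemble H, and a port edge of G may belong to the other part only. *)
Definition side_edge : rel G := fun x y =>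
  [|| x \notin ports G, y \notin ports G
    | [exists i, exists l, [&& x == port G i, y == port G l & edge (port H i) (port H l)]]].

Lemma side_edge_sym : symmetric side_edge.
Proof.
have sub x y : side_edge x y -> side_edge y x.
  case/or3P=> [h|h|]; rewrite /side_edge ?h ?orbT //.
  move=> /existsP[i /existsP[l /and3P[xi yl il]]]; apply/or3P; apply: Or33.
  by apply/existsP; exists l; apply/existsP; exists i; rewrite xi yl edge_sym il.
by move=> x y; apply/idP/idP; apply: sub.
Qed.

Lemma side_port i : port G i \in side_set.
Proof. by rewrite in_setU mem_port_set orbT. Qed.

Lemma side_edge_port i l : side_edge (port G i) (port G l) = edge (port H i) (port H l).
Proof.
rewrite /side_edge !mem_port_set /=; apply/existsP/idP.
  by move=> [i' /existsP[l' /and3P[/eqP/port_inj-> /eqP/port_inj->]]].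
by move=> il; exists i; apply/existsP; exists l; rewrite !eqxx.
Qed.

Hypothesis U_closed : off_ports_closed (port G) U.
Hypothesis port_sub : forall i l, edge (port H i) (port H l) -> edge (port G i) (port G l).
Variable phi : formula k.
Variable N : nat.
Hypothesis N_gt0 : 0 < N.
Hypothesis rankN : rank phi <= N.
Hypothesis same_type :
  type (port G) U N (no_val G) = type (port H) (~: ports H) N (no_val H).

(** The new part has the port edges of H and, off the ports, the type of H at rank N, so [sat_type]
    transfers [phi]. *)
Lemma side_part : sat phi (port H) ->
  exists En : exists x, x \in side_set,
    sat phi (port (subgraph side_edge_sym side_port En)).
Proof.
move=> Hphi.
have En : exists x, x \in side_set.
  have /card_gt0P[x _] := graph_nonempty H.
  case: (boolP (x \in ports H)) => [/port_setP[i _]|xP].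
    by exists (port G i); apply: side_port.
  (* One round, available since N is positive, turns a vertex of H off the ports into a vertex of
     U. *)
  have := same_type; case: (N) N_gt0 => // n _ e.
  have [|a aU _] := type_back e (b := x); first by rewrite inE.
  by exists a; rewrite in_setU aU.
exists En; set S := subgraph _ _ _.
have PS (x : S) : (val x \in ports G) = (x \in ports S).
  apply: (@mem_port_set_embed k S G (port S) (port G) (val : S -> G)) => //.
  exact: val_inj.
have US : (val : S -> G) @: (~: ports S) = U.
  apply/setP => u; apply/imsetP/idP.
    move=> [x xP ->]; move: xP; rewrite inE -PS.
    by have := valP x; rewrite /= in_setU; case: (_ \in U) => //= ->.
  move=> uU; have uS : u \in side_set by rewrite in_setU uU.
  exists (exist _ u uS) => //; rewrite inE -PS /=.
  exact: (proj1 U_closed).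
have typeS : type (port S) (~: ports S) N (no_val S) = type (port G) U N (no_val G).
  rewrite -US (val0_eq (no_val G) ((val : S -> G) \o no_val S)); symmetry.
  apply: type_embed => //.
  - exact: val_inj.
  - move=> x y; rewrite -PS => xP; rewrite /= /sub_edge.
    by rewrite /side_edge xP /= andbT.
  - move=> x z; rewrite -PS => xP xz.
    have zS : z \in side_set.
      rewrite in_setU; case: (boolP (z \in ports G)) => zP; first by rewrite orbT.
      rewrite orbF; apply: (proj2 U_closed (val x)) => //.
      by have := valP x; rewrite /= in_setU (negbTE xP) orbF.
    by exists (exist _ z zS).
  - by case.
have same : same_ports (port H) (port S).
  move=> i l; rewrite /= /sub_edge /= side_edge_port.
  by apply/idP/andP => [il|[_ //]]; split=> //; apply: port_sub.
have := @sat_type k k phi H S (port H) (port S) 0 (no_val H) (no_val S) inl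
  (@port_inj _ H) (@port_inj _ S) same.
move=> h; apply/h => //; try by case.
by apply: (type_leq rankN); rewrite typeS same_type.
Qed.

End SidePart.

(** * Splitting the components of a graph *)

Lemma exists_subset (T : finType) (A : {set T}) m :
  m <= #|A| -> exists2 B : {set T}, B \subset A & #|B| = m.
Proof.
elim: m => [|m IH] mA; first by exists set0; rewrite ?sub0set ?cards0.
have [B BA cB] := IH (ltnW mA).
have : B \proper A by rewrite properEcard BA cB.
case/properP=> _ [x xA xB]; exists (x |: B); last by rewrite cardsU1 xB cB.
by apply/subsetP => y; rewrite !inE => /orP[/eqP->|/(subsetP BA)].
Qed.

Lemma card_free_roots_split k N (G : graph) (p : 'I_k -> G) (A U V : {set G}) t j
    (v : 'I_j -> G) :
  A = U :|: V -> [disjoint U & V] ->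
  #|@free_roots k N G p A t j v| = #|free_roots p U t v| + #|free_roots p V t v|.
Proof.
move=> -> dis; rewrite -(cardsID U); congr (_ + _); apply: eq_card => x.
  by rewrite !inE; case: (x \in U); rewrite ?andbF ?andbT.
rewrite !inE; case: (boolP (x \in U)) => xU //=.
by have := disjointFr dis xU => ->.
Qed.

(** Below [2 * N] the total is exact and a itself works. Otherwise a side with fewer than N receives
    exactly its number, which leaves at least N for the other; if both have at least N, one receives
    N and the other the rest. *)
Lemma split_count N a b c : (forall m, m <= 2 * N -> (m <= a + b) = (m <= c)) ->
  exists a', [/\ a' <= c, minn N a = minn N a' & minn N b = minn N (c - a')].
Proof.
move=> h; have h2 := h (2 * N) (leqnn _).
case: (leqP (2 * N) c) => cN.
  case: (leqP N a) => aN; last by exists a; split; lia.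
  case: (leqP N b) => bN; first by exists N; split; lia.
  by exists (c - b); split; lia.
have e : a + b = c by have := h (a + b); have := h c; lia.
by exists a; split; lia.
Qed.

Lemma split_closed k N (G : pgraph k) (A : ty k N 0 -> {set G}) :
  let p := port G in
  (forall t, A t \subset free_roots p (~: port_set p) t (no_val G)) ->
  exists U V : {set G}, [/\ off_ports_closed p U, off_ports_closed p V,
    ~: port_set p = U :|: V, [disjoint U & V]
  & forall t, free_roots p U t (no_val G) = A t].
Proof.
move=> p AR; set P := port_set p.
(* The selection depends on the component of x only, hence is constant along edges off the ports. *)
pose sel x := root (avoid P) x \in A (type p (component p x) N (no_val G)).
have sel_edge x y : edge x y -> x \notin P -> y \notin P -> sel x = sel y.
  move=> xy xP yP; have cxy : connect (avoid P) x y by apply: connect1; rewrite /avoid xy xP.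
  rewrite /sel (component_eq (x := x) (y := y)) ?inE //.
  by rewrite (rootP (@avoid_connect_sym _ _) cxy).
exists [set x in ~: P | sel x], [set x in ~: P | ~~ sel x]; split.
- split=> [x|x y]; first by rewrite !inE => /andP[].
  rewrite !inE => /andP[xP xs] xy yP; rewrite -/P in yP.
  by rewrite yP -(sel_edge x).
- split=> [x|x y]; first by rewrite !inE => /andP[].
  rewrite !inE => /andP[xP xs] xy yP; rewrite -/P in yP.
  by rewrite yP -(sel_edge x).
- by apply/setP => x; rewrite !inE -andb_orr orbN andbT.
- by apply/pred0P => x /=; rewrite !inE; case: (sel x); rewrite ?andbF.
- move=> t; apply/setP => r; apply/idP/idP.
    rewrite !inE => /andP[/andP[rP rs] /and3P[/eqP rr /eqP tr _]].
    by move: rs; rewrite /sel rr tr.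
  move=> rA; have := subsetP (AR t) r rA; rewrite !inE => /and4P[rP rr tr h].
  by rewrite rP rr tr h /sel (eqP rr) (eqP tr) rA.
Qed.

Lemma definable_fusion k (L M : language k) :
  separator_definable L -> separator_definable M ->
  separator_definable (lift_op2 (@fusion k) L M).
Proof.
move=> [phi Lphi] [psi Mpsi].
(* Rank at least 1 lets a type tell whether there is a vertex off the ports, so that the rebuilt
   parts are nonempty. *)
pose N := maxn 1 (maxn (rank phi) (rank psi)).
have N_gt0 : 0 < N by rewrite leq_max.
have phiN : rank phi <= N by rewrite /N; lia.
have psiN : rank psi <= N by rewrite /N; lia.
pose I : finType := (ty k N 0 * 'I_(2 * N).+1 + 'I_k * 'I_k)%type.
pose P (i : I) : property 'I_k := match i with
  | inl (t, m) => fun G w => m <= #|free_roots w (~: port_set w) t (no_val G)|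
  | inr (i, l) => fun G w => edge (w i) (w l)
  end.
apply: (@invariant_definable _ _ I P).
  case=> [[t m]|[i l]]; last exact: definable_edge.
  have := definable_count id t m (no_val 'I_k); apply: eq_definable => G w /=.
  by rewrite (val0_eq (no_val G) (w \o no_val _)).
move=> G G' PGG' [H [K [LH MK /fusion_isoP[f [g fg]]]]].
have [[fi gi fp gp] cov meet [ef eg] efg] := fg.
have edge_port i l : edge (port G i) (port G l) = edge (port G' i) (port G' l).
  by apply/idP/idP; have [h1 h2] := PGG' (inr (i, l)).
have gf := fusion_embeddings_sym fg.
set U := f @: (~: port_set (port H)); set V := g @: (~: port_set (port K)).
(* For each type, [A] selects the components of [G'] that go to the first part, so that the two
   parts agree with U and V in their counts up to N. *)
have /fin_all_exists[A hA] (t : ty k N 0) : exists A : {set G'},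
    [/\ A \subset free_roots (port G') (~: port_set (port G')) t (no_val G'),
        minn N #|free_roots (port G) U t (no_val G)| = minn N #|A|
      & minn N #|free_roots (port G) V t (no_val G)| =
        minn N (#|free_roots (port G') (~: port_set (port G')) t (no_val G')| - #|A|)].
  set c := #|free_roots (port G') _ t _|.
  have [|a' [a'c ha hb]] := @split_count N #|free_roots (port G) U t (no_val G)|
      #|free_roots (port G) V t (no_val G)| c.
    move=> m mN; rewrite -(@card_free_roots_split k N G (port G) (~: port_set (port G)) U V).
    - have mN' : m < (2 * N).+1 by [].
      by apply/idP/idP; have [] := PGG' (inl (t, Ordinal mN')).
    - exact: fusion_side_cover.
    - exact: fusion_side_disjoint fg.
  have [B BR cB] := exists_subset a'c.
  by exists B; rewrite cB; split.
have [U' [V' [U'c V'c cov' dis' U'A]]] := split_closed (fun t => let: And3 h _ _ := hA t in h).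
have V'A t : #|free_roots (port G') V' t (no_val G')| =
    #|free_roots (port G') (~: port_set (port G')) t (no_val G')| - #|A t|.
  by rewrite (card_free_roots_split (port G') t (no_val G') cov' dis') U'A addKn.
have typeU : type (port G') U' N (no_val G') =
    type (port H) (~: port_set (port H)) N (no_val H).
  rewrite -(fusion_side_type fg); apply: type_of_counts => //.
    exact: fusion_side_off_ports fg.
  by move=> t; have [_ h _] := hA t; rewrite U'A h.
have typeV : type (port G') V' N (no_val G') =
    type (port K) (~: port_set (port K)) N (no_val K).
  rewrite -(fusion_side_type gf); apply: type_of_counts => //.
    exact: fusion_side_off_ports gf.
  by move=> t; have [_ _ h] := hA t; rewrite V'A h.
have subH i l : edge (port H i) (port H l) -> edge (port G' i) (port G' l).
  by move=> /ef; rewrite !fp edge_port.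
have subK i l : edge (port K i) (port K l) -> edge (port G' i) (port G' l).
  by move=> /eg; rewrite !gp edge_port.
have [EH satH] := side_part U'c subH N_gt0 phiN typeU (proj1 (Lphi H) LH).
have [EK satK] := side_part V'c subK N_gt0 psiN typeV (proj1 (Mpsi K) MK).
eexists; eexists; split; [apply/Lphi; exact: satH|apply/Mpsi; exact: satK|].
apply: fusion_subgraphs.
- move=> z; have /setP/(_ z) := cov'; rewrite !inE.
  by case: (z \in port_set _); rewrite ?orbT //= !orbF => <-.
- move=> z; rewrite !in_setU => /orP[zU|/port_setP //] /orP[zV|/port_setP //].
  by have := disjointFr dis' zU; rewrite zV.
- move=> x y xy.
  case: (boolP (x \in port_set (port G'))) => xP; last first.
    have /setP/(_ x) := cov'; rewrite in_setC xP in_setU => /esym/orP[xU|xV].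
      apply/orP; left; rewrite !in_setU xU /side_edge xP /= andbT.
      case: (boolP (y \in port_set (port G'))) => yP; first by rewrite orbT.
      by rewrite (proj2 U'c x).
    apply/orP; right; rewrite !in_setU xV /side_edge xP /= andbT.
    case: (boolP (y \in port_set (port G'))) => yP; first by rewrite orbT.
    by rewrite (proj2 V'c x).
  case: (boolP (y \in port_set (port G'))) => yP; last first.
    have /setP/(_ y) := cov'; rewrite in_setC yP in_setU => /esym/orP[yU|yV].
      by apply/orP; left; rewrite !in_setU yU /side_edge yP xP !orbT.
    by apply/orP; right; rewrite !in_setU yV /side_edge yP xP !orbT.
  rewrite !in_setU xP yP !orbT /=.
  have [i xi] := port_setP _ _ xP; have [l yl] := port_setP _ _ yP.
  rewrite xi yl !side_edge_port.
  rewrite xi yl -edge_port in xy.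
  (* An edge between ports of [G'] is also one of G, hence comes from H or from K, and the part
     rebuilt from that graph has it. *)
  apply/orP; case: (efg _ _ xy) => -[x' [y' [ix ly xy']]]; [left|right].
    by move: ix ly; rewrite -!fp => /fi-> /fi->.
  by move: ix ly; rewrite -!gp => /gi-> /gi->.
Qed.

(** * Star-free languages are definable *)

(** The isomorphism is guessed as an enumeration u of the vertices of G, indexed by the vertices of
    F. *)
Lemma definable_iso k (F : pgraph k) : separator_definable (fun G => pgraph_iso G F).
Proof.
pose n := #|{: F}|.
pose P (G : graph) (w : 'I_k -> G) (u : 'I_n -> G) := 
  ((forall x y, x != y -> u x <> u y) /\ (forall a, exists x, u x = a)) /\
  ((forall x y, edge (u x) (u y) <-> edge (enum_val x : F) (enum_val y)) /\
   (forall i, w i = u (enum_rank (port F i)))).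
apply/separator_definableP; exists (fun G w => exists u, P G w u).
  apply: definable_ex_ord; apply: definable_and; apply: definable_and.
  - apply: definable_forall => x; apply: definable_forall => y.
    case: (x =P y) => [xy|xy].
      by apply: eq_definable (definable_true _) => G w; split.
    apply: eq_definable (definable_not (definable_eq (inr x) (inr y))) => G w.
    by split=> // h; apply: h.
  - apply: (@definable_all ('I_k + 'I_n) (fun G w => exists x, w (Some (inr x)) = w None)).
    by apply: definable_exists => x; apply: definable_eq.
  - apply: definable_forall => x; apply: definable_forall => y; apply: definable_iff.
      exact: definable_edge (inr x) (inr y).
    exact: definable_const.
  - apply: definable_forall => i; exact: definable_eq (inl i) (inr _).
move=> G; split=> [/pgraph_iso_sym[f [bf fe fp]]|[u [[ui us] [ue up]]]].
  exists (f \o enum_val); split; split.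
  - move=> x y xy /(bij_inj bf)/enum_val_inj e; by rewrite e eqxx in xy.
  - have [g fK gK] := bf; move=> a; exists (enum_rank (g a)).
    by rewrite /= enum_rankK gK.
  - by move=> x y /=; rewrite fe.
  - by move=> i /=; rewrite enum_rankK fp.
have uinj : injective u.
  by move=> x y e; apply/eqP/negPn/negP => /ui.
apply: pgraph_iso_sym; exists (u \o enum_rank); split.
- have us' a : exists x, u x == a by have [x <-] := us a; exists x.
  exists (fun a => enum_val (xchoose (us' a))) => [x|a] /=.
    apply: enum_rank_inj; apply: uinj; rewrite enum_valK.
    exact: (eqP (xchooseP (us' _))).
  by rewrite enum_valK; apply/eqP/(xchooseP (us' a)).
- by move=> x y /=; have := ue (enum_rank x) (enum_rank y); rewrite !enum_rankK => e; apply/idP/idP => /e.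
- by move=> i; rewrite up.
Qed.

Lemma definable_finite k (L : language k) : finite_language L -> separator_definable L.
Proof.
move=> [Lg [n [F LF]]]; apply/separator_definableP.
have /fin_all_exists[phi def] (i : 'I_n) : exists phi : formula k,
    forall G, pgraph_iso G (F i) <-> language_of phi G by apply: definable_iso.
(* The list F may contain graphs outside L; the constant [L (F i)] drops them. *)
exists (fun G w => exists i : 'I_n, L (F i) /\ sat (phi i) w).
  apply: definable_exists => i; apply: definable_and; first exact: definable_const.
  exact: definable_sat.
move=> G; split=> [LG|[i [LFi /def Gi]]].
  have [i Gi] := LF G LG; exists i; split; last exact/def.
  exact: Lg Gi LG.
exact: Lg (pgraph_iso_sym Gi) LFi.
Qed.

Lemma definable_forget k (L : language k.+1) :
  separator_definable L -> separator_definable (lift_op (@forget k) L).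
Proof.
move=> [phi Lphi]; apply/separator_definableP.
(* The witness avoids the remaining ports because the ports of a graph of arity [k.+1] are
   distinct. *)
exists (fun (G : graph) (w : 'I_k -> G) => exists a, (forall i, w i <> a) /\ sat phi (snoc w a)).
  have := definable_ex (definable_and
    (definable_forall (fun i : 'I_k => definable_not (definable_eq (Some i) None)))
    (definable_subst (snoc Some None) (definable_sat phi))).
  apply: eq_definable => G w.
  have wE a : oapp w a \o snoc Some None = snoc w a by rewrite comp_snoc.
  by split=> -[a [h1 h2]]; exists a; split; rewrite ?wE // -?wE.
move=> G; split=> [[H [/Lphi LH [f [bf fe fp]]]]|[a [na sa]]].
  have [g fK gK] := bf; exists (g (port H ord_max)); split.
    move=> i e; have := fp i; rewrite e gK /= /forget_port widen_lift.
    by move/port_inj/eqP; rewrite (negbTE (neq_lift _ _)).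
  rewrite (sat_iso _ _ bf fe) comp_snoc gK.
  have -> : f \o port G = port H \o lift ord_max; last by rewrite snoc_eta.
  by apply: functional_extensionality => i /=; rewrite fp /= /forget_port widen_lift.
have inj : injective (snoc (port G) a).
  move=> x y; rewrite /snoc; case: unliftP => [x' ->|->]; case: unliftP => [y' ->|->] //.
  - by move=> /port_inj->.
  - by move/na.
  - by move/esym/na.
exists (PGraph inj); split; first exact/Lphi.
exists id; split=> //; first by exists id.
by move=> i; rewrite /= /forget_port /= widen_lift snoc_lift.
Qed.

Lemma definable_sat_on X l (phi : formula l) (x : X) (r : 'I_l -> X) :
  definable (fun G w => sat_on (fun a => a != w x) phi (w \o r)).
Proof.
elim: phi X x r => {l}
  [l a b|l a b|l n a b z|l phi IH|l phi IH psi IH'|l phi IH psi IH'|l phi IH|l phi IH] X x r.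
- exact: eq_definable (fun _ _ => iff_refl _) (definable_subst r (definable_sat (FEq a b))).
- exact: eq_definable (fun _ _ => iff_refl _) (definable_subst r (definable_sat (FEdge a b))).
- exact: eq_definable (fun _ _ => iff_refl _) (definable_subst r (definable_sat (FSep a b z))).
- by apply: definable_not; apply: IH.
- by apply: definable_and; [apply: IH|apply: IH'].
- by apply: definable_or; [apply: IH|apply: IH'].
- have := definable_ex (definable_and (definable_not (definable_eq None (Some x)))
    (IH (option X) (Some x) (snoc (Some \o r) None))).
  apply: eq_definable => G w /=.
  have wE a : oapp w a \o snoc (Some \o r) None = snoc (w \o r) a by rewrite comp_snoc.
  by split=> [[a [/eqP h1 h2]]|[a /eqP h1 h2]]; exists a; rewrite ?wE // -?wE.
- have := definable_all (definable_or (definable_eq None (Some x))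
    (IH (option X) (Some x) (snoc (Some \o r) None))).
  apply: eq_definable => G w /=.
  have wE a : oapp w a \o snoc (Some \o r) None = snoc (w \o r) a by rewrite comp_snoc.
  split=> h a; first by move=> /eqP na; have := h a; rewrite wE => -[].
  by case: (altP (a =P w x)) => na; [left|right; rewrite wE; apply: h].
Qed.

(** An isolated vertex lies on no path between other vertices, so [phi] relativised to these can be
    evaluated in the whole graph. The formula also asks for another vertex, since the graph that
    receives the new port is nonempty. *)
Lemma definable_add k (L : language k) :
  separator_definable L -> separator_definable (lift_op (@add k) L).
Proof.
move=> [phi Lphi]; apply/separator_definableP.
exists (fun (G : graph) (w : 'I_k.+1 -> G) => (forall a, ~ edge (w ord_max) a) /\
  ((exists a, a <> w ord_max) /\
   sat_on (fun a => a != w ord_max) phi (w \o lift ord_max))).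
  apply: definable_and; last apply: definable_and.
  - exact: (definable_all (definable_not (definable_edge (Some ord_max) None))).
  - exact: (definable_ex (definable_not (definable_eq None (Some ord_max)))).
  - exact: definable_sat_on.
move=> G; split=> [[H [/Lphi LH /pgraph_iso_sym[f [bf fe fp]]]]|[iso [ne sG]]].
  have fi := bij_inj bf; have [g fK gK] := bf.
  have pE : port G ord_max = f None by rewrite -fp /= /add_port snoc_max.
  pose e (x : H) : G := f (Some x).
  have eE u : u != port G ord_max -> exists x, u = e x.
    rewrite pE => nu; case gu : (g u) => [x|]; first by exists x; rewrite /e -gu gK.
    by rewrite -gu gK eqxx in nu.
  split; [|split].
  - by move=> a; rewrite pE -(gK a) fe.
  - have /card_gt0P[x _] := graph_nonempty H; exists (e x); rewrite pE.
    by move/fi.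
  - have := LH; rewrite /language_of (@sat_embed H G e).
    + have -> : e \o port H = port G \o lift ord_max.
        by apply: functional_extensionality => i; rewrite /= -fp /= /add_port snoc_lift.
      suff -> : (fun x => x \in codom e) = (fun a => a != port G ord_max) by [].
      apply: functional_extensionality => u; apply/codomP/idP => [[x ->]|/eE //].
      by rewrite pE; apply/eqP => /fi.
    + by move=> x y /fi [].
    + by move=> x y; rewrite /e fe.
    + by move=> x z xz; apply: eE; apply: contraTneq xz => ->; rewrite pE fe.
pose z := port G ord_max.
have ports i : port (forget G) i \in [set~ z].
  by rewrite !inE /= /forget_port widen_lift (inj_eq (@port_inj _ G)) eq_sym neq_lift.
have ne' : exists x : forget G, x \in [set~ z].
  by have [a /eqP az] := ne; exists a; rewrite !inE.
pose H := @subgraph k (forget G) [set~ z] (fun _ _ => true) (fun _ _ => erefl) ports ne'.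
pose e (x : H) : G := val x.
have ez x : e x != z by have := valP x; rewrite !inE.
have eE u : u != z -> exists x, u = e x.
  move=> uz; have uz' : u \in [set~ z] by rewrite !inE.
  by exists (exist _ u uz').
have e_edge x y : edge (e x) (e y) = edge x y by rewrite /= /sub_edge andbT.
have ei : injective e by apply: val_inj.
have nz u : edge u z = false by apply/negP; rewrite edge_sym => /iso.
exists H; split.
  apply/Lphi; rewrite /language_of (@sat_embed H G e) //; last first.
    by move=> x u xu; apply: eE; apply: contraTneq xu => ->; rewrite nz.
  have -> : e \o port H = port G \o lift ord_max.
    by apply: functional_extensionality => i; rewrite /= -widen_lift.
  suff -> : (fun x => x \in codom e) = (fun a => a != port G ord_max) by [].
  by apply: functional_extensionality => u; apply/codomP/idP => [[x ->]|/eE //].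
apply: pgraph_iso_sym; pose h (u : add H) : G := oapp e z u.
have hinj : injective h.
  case=> [x|] [y|] //= e1; first by rewrite (ei _ _ e1).
    by have := ez x; rewrite e1 eqxx.
  by have := ez y; rewrite -e1 eqxx.
have hsurj u : exists x, h x == u.
  by case: (altP (u =P z)) => [->|/eE[x ->]]; [exists None|exists (Some x)].
exists h; split.
- exists (fun u => xchoose (hsurj u)) => [x|u]; last exact: (eqP (xchooseP (hsurj u))).
  apply: hinj; exact: (eqP (xchooseP (hsurj _))).
- by case=> [x|] [y|]; rewrite /h /= ?e_edge ?nz // edge_sym nz.
- move=> i; rewrite /h /= /add_port; case: (unliftP ord_max i) => [l ->|->].
    by rewrite snoc_lift /= -widen_lift.
  by rewrite snoc_max.
Qed.

Lemma definable_permute k (s : 'S_k) (L : language k) :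
  separator_definable L -> separator_definable (lift_op (permute s) L).
Proof.
move=> [phi Lphi]; apply/separator_definableP.
(* Port i of [permute s H] is port [s i] of H, hence the inverse. *)
exists (fun G w => sat phi (w \o (s^-1)%g)).
  exact: (@definable_subst _ _ (s^-1)%g (fun G w => sat phi w)) (definable_sat phi).
move=> G; split=> [[H [/Lphi LH [f [bf fe fp]]]]|sG].
  rewrite (sat_iso _ _ bf fe); have -> // : f \o (port G \o (s^-1)%g) = port H.
  by apply: functional_extensionality => i; rewrite /= fp /= permKV.
exists (permute s^-1 G); split; first exact/Lphi.
exists id; split=> //; first by exists id.
by move=> i; rewrite /= permK.
Qed.

Lemma star_free_definable k (L : language k) : star_free L -> separator_definable L.
Proof.
elim=> {k L}
  [k L M LM _ [phi def]|k L|k L M _ [phi Lphi] _ [psi Mpsi]|k L M _ [phi Lphi] _ [psi Mpsi]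
  |k L _ [phi Lphi]|k L M _ HL _ HM|k L _|k L _|k s L _].
- by exists phi => G; rewrite -LM.
- exact: definable_finite.
- by exists (FOr phi psi) => G; rewrite Lphi Mpsi.
- by exists (FAnd phi psi) => G; rewrite Lphi Mpsi.
- by exists (FNot phi) => G; rewrite Lphi.
- exact: definable_fusion.
- exact: definable_forget.
- exact: definable_add.
- exact: definable_permute.
Qed.

Theorem mainTheorem1 (k : nat) (L : language k) (hL : graph_language L) :
  star_free L <-> separator_definable L.
Proof. by split; [apply: star_free_definable|apply: definable_star_free]. Qed.
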